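(* Let $\mathcal{P}=\{(N_{\mathsf{t}},T_{\mathsf{t}})\}_{\mathsf{t}=0}^{\mathsf{M}}$ be any time-like path, i.e., $(N_0,T_0)=(1,0)$ and for each $\mathsf{t}$ exactly one of $N_{\mathsf{t}+1}-N_{\mathsf{t}}$, $T_{\mathsf{t}+1}-T_{\mathsf{t}}$ equals $1$ and the other equals $0$. Then the joint distribution of the random variables $\{\mathfrak{h}^{\mathrm{Ber}}(N_{\mathsf{t}}+1,T_{\mathsf{t}})\}_{\mathsf{t}=0}^{\mathsf{M}}$ of the inhomogeneous stochastic higher spin six vertex model with the step Bernoulli boundary condition is the same as the joint distribution of $\{\mathbf{x}_{N_{\mathsf{t}}}(N_{\mathsf{t}},T_{\mathsf{t}})+N_{\mathsf{t}}\}_{\mathsf{t}=0}^{\mathsf{M}}$ under the mixed geometric/Bernoulli $q$-TASEP along $\mathcal{P}$ described in the context.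
   Context: Fix $q\in(0,1)$; $(z;q)_k=\prod_{i=0}^{k-1}(1-zq^i)$. Parameters: $u_1,u_2,\ldots\in(-\infty,0)$; $a_1,a_2,\ldots\in(0,\infty)$ uniformly bounded away from $0$ and $\infty$; $\nu_1=0$ and $\nu_2,\nu_3,\ldots\in(0,1)$ uniformly bounded away from $0$ and $1$; $\mathsf{c}_j:=\nu_j/a_j$ and $a_i\mathsf{c}_j<1$ for all $i,j$. Vertex weights $\mathsf{L}_{u,a,\nu}(i_1,j_1;i_2,j_2)$, $i_1,i_2\in\mathbb{Z}_{\ge0}$, $j_1,j_2\in\{0,1\}$ ($i_1,j_1$ arrows entering from below/left; $i_2,j_2$ leaving upward/right), vanish unless $i_1+j_1=i_2+j_2$, and for $g\in\mathbb{Z}_{\ge0}$: $\mathsf{L}(g,0;g,0)=\frac{1-auq^g}{1-au}$, $\mathsf{L}(g,0;g-1,1)=\frac{-au(1-q^g)}{1-au}$, $\mathsf{L}(g,1;g,1)=\frac{\nu q^g-au}{1-au}$, $\mathsf{L}(g,1;g+1,0)=\frac{1-\nu q^g}{1-au}$. The model with step Bernoulli boundary condition: random up-right paths in $\mathbb{Z}_{\ge1}^2$ (vertical edges may carry several arrows, horizontal at most one); one arrow enters each vertex $(1,T)$, $T\ge1$, from the left, none from the bottom; inductively over $N+T$, at each vertex $(N,T)$ with incoming $(i_1,j_1)$, the outgoing $(i_2,j_2)$ are sampled independently with probability $\mathsf{L}_{u_T,a_N,\nu_N}(i_1,j_1;i_2,j_2)$ (since $\nu_1=0$, the edge from $(1,T)$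 to $(2,T)$ independently carries an arrow with probability $-a_1u_T/(1-a_1u_T)$). $\mathfrak{h}^{\mathrm{Ber}}(N,T)$ is the total number of arrows on vertical edges from $(x,T)$ to $(x,T+1)$ with $x\ge N$. $q$-TASEP: for $\gamma\in(0,1)$, $\mathbf{p}_{m,\gamma}(j)=\gamma^j(\gamma;q)_{m-j}\frac{(q;q)_m}{(q;q)_j(q;q)_{m-j}}$, $0\le j\le m$, and $\mathbf{p}_{+\infty,\gamma}(j)=\gamma^j(\gamma;q)_\infty/(q;q)_j$. Particle configurations $x_1>x_2>\ldots$ in $\mathbb{Z}$, convention $x_0=+\infty$; particle $i$ has rate $a_i$. Geometric move $\mathbf{G}_\alpha$: each particle $i$ independently jumps right by $j$ with probability $\mathbf{p}_{x_{i-1}-x_i-1,\,a_i\alpha}(j)$. Bernoulli move $\mathbf{B}_\beta$ ($\beta>0$): sequentially for $i=1,2,\ldots$, particle $i$ jumps right by one with probability $a_i\beta/(1+a_i\beta)$ if $i=1$ or particle $i-1$ has jumped in this move, and with probability $(1-q^{x_{i-1}-x_i-1})a_i\beta/(1+a_i\beta)$ otherwise (gaps before the move). The mixed $q$-TASEP along $\mathcal{P}$: $\vec{\mathbf{x}}(1,0)$ is the step configuration $\mathbf{x}_i(1,0)=-i$, $i\ge1$; for $\mathsf{t}=0,\ldots,\mathsf{M}-1$, $\vec{\mathbf{x}}(N_{\mathsf{t}+1},T_{\mathsf{t}+1})$ is obtained from $\vec{\mathbf{x}}(N_{\mathsf{t}},T_{\mathsf{t}})$ by an independent move $\mathbf{B}_{-u_{T_{\mathsf{t}+1}}}$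 if $T_{\mathsf{t}+1}=T_{\mathsf{t}}+1$, and by an independent move $\mathbf{G}_{\mathsf{c}_{N_{\mathsf{t}+1}}}$ if $N_{\mathsf{t}+1}=N_{\mathsf{t}}+1$. *)

(* Defs.v *)
From HB Require Import structures.
From mathcomp Require Import all_boot all_order all_algebra.
From mathcomp Require Import all_classical all_reals all_analysis.

Set Implicit Arguments.
Unset Strict Implicit.
Unset Printing Implicit Defensive.

Import Order.TTheory GRing.Theory Num.Theory.
Import numFieldNormedType.Exports.
Local Open Scope ring_scope.

Section Defs.
Variable R : realType.

Definition qpoch (z q : R) (k : nat) : R := \prod_(i < k) (1 - z * q ^+ i).

Definition qpoch_inf (z q : R) : R := limn (fun k => qpoch z q k).

Definition Lw (q u a nu : R) (i1 j1 i2 j2 : nat) : R :=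
  if (i1 + j1 != i2 + j2)%N then 0 else
  match j1, j2 with
  | 0%N, 0%N => (1 - a * u * q ^+ i1) / (1 - a * u)
  | 0%N, 1%N => (- (a * u) * (1 - q ^+ i1)) / (1 - a * u)
  | 1%N, 1%N => (nu * q ^+ i1 - a * u) / (1 - a * u)
  | 1%N, 0%N => (1 - nu * q ^+ i1) / (1 - a * u)
  | _, _ => 0
  end.

(* A configuration of the vertex model in the box {1..K} x {1..Tm} is given
   by the horizontal outgoing bits j2 at every vertex (x,t) (1-based). *)
Definition getb (K Tm : nat) (f : {ffun 'I_K * 'I_Tm -> bool}) (x t : nat) : bool :=
  match @insub nat (fun k => k < K)%N 'I_K x.-1, @insub nat (fun k => k < Tm)%N 'I_Tm t.-1 with
  | Some x', Some t' => if ((0 < x) && (0 < t))%N then f (x', t') else false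
  | _, _ => false
  end.

(* number of arrows entering vertex (x,t) from the left: one arrow enters
   every (1,t) from the left *)
Definition hin K Tm (f : {ffun 'I_K * 'I_Tm -> bool}) (x t : nat) : nat :=
  if x == 1%N then 1%N else nat_of_bool (getb f x.-1 t).

(* number of arrows on the vertical edge from (x,t) to (x,t+1); no arrow
   enters from the bottom (vert _ x 0 = 0) *)
Fixpoint vert K Tm (f : {ffun 'I_K * 'I_Tm -> bool}) (x t : nat) : nat :=
  match t with
  | 0%N => 0%N
  | t'.+1 => (vert f x t' + hin f x t - nat_of_bool (getb f x t))%N
  end.

Definition vweight (q : R) (u a nu : nat -> R) K Tm
    (f : {ffun 'I_K * 'I_Tm -> bool}) : R :=
  \prod_(x < K) \prod_(t < Tm)
    Lw q (u t.+1) (a x.+1) (nu x.+1)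
       (vert f x.+1 t) (hin f x.+1 t.+1) (vert f x.+1 t.+1) (getb f x.+1 t.+1).

(* height function restricted to the box: arrows on vertical edges from
   (x,T) to (x,T+1) with N <= x <= K *)
Definition hbox K Tm (f : {ffun 'I_K * 'I_Tm -> bool}) (N T : nat) : nat :=
  (\sum_(N <= x < K.+1) vert f x T)%N.

(* Joint probability, in the model truncated to columns 1..K and rows
   1..T_M, that h(N_t + 1, T_t) = k_t for t = 0..M. *)
Definition PVbox (q : R) (u a nu : nat -> R) (N T : nat -> nat) (M K : nat)
    (k : 'I_M.+1 -> int) : R :=
  \sum_(f : {ffun 'I_K * 'I_(T M) -> bool})
     vweight q u a nu f *
     (([forall s : 'I_M.+1, (hbox f (N s).+1 (T s))%:Z == k s]) %:R).

Definition pfin (q : R) (m : nat) (g : R) (j : nat) : R :=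
  if (j <= m)%N then
    g ^+ j * qpoch g q (m - j) * (qpoch q q m / (qpoch q q j * qpoch q q (m - j)))
  else 0.

Definition pinf (q : R) (g : R) (j : nat) : R :=
  g ^+ j * qpoch_inf g q / qpoch q q j.

(* A trajectory of the first n particles over the M moves: J (s,i) is the
   jump of particle i+1 during move s+1.  getJ uses 0-based move index s
   and 1-based particle index i. *)
Definition getJ (M n : nat) (J : {ffun 'I_M * 'I_n -> nat}) (s i : nat) : nat :=
  match @insub nat (fun k => k < M)%N 'I_M s, @insub nat (fun k => k < n)%N 'I_n i.-1 with
  | Some s', Some i' => if (0 < i)%N then J (s', i') else 0%N
  | _, _ => 0%N
  end.

(* position of particle i after s moves; step initial condition x_i = -i *)
Definition pos M n (J : {ffun 'I_M * 'I_n -> nat}) (s i : nat) : int :=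
  - (i%:Z) + (\sum_(r < s) getJ J r i)%:Z.

(* gap x_{i-1} - x_i - 1 before move s (i >= 2); it is nonnegative on every
   trajectory of positive probability *)
Definition gap M n (J : {ffun 'I_M * 'I_n -> nat}) (s i : nat) : nat :=
  absz (pos J s i.-1 - pos J s i - 1)%R.

Definition stepw (q : R) (u a nu : nat -> R) (N T : nat -> nat) M n
    (J : {ffun 'I_M * 'I_n -> nat}) (s i : nat) : R :=
  let j := getJ J s i in
  if T s.+1 == (T s).+1 then
    let beta := - u (T s.+1) in
    let r := a i * beta / (1 + a i * beta) in
    let rho := if (i == 1%N) || (getJ J s i.-1 == 1%N) then r
               else (1 - q ^+ (gap J s i)) * r in
    if j == 0%N then 1 - rho else if j == 1%N then rho else 0
  else
    let alpha := nu (N s.+1) / a (N s.+1) in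
    if i == 1%N then pinf q (a i * alpha) j
    else pfin q (gap J s i) (a i * alpha) j.

Definition tweight (q : R) (u a nu : nat -> R) (N T : nat -> nat) M n
    (J : {ffun 'I_M * 'I_n -> nat}) : R :=
  \prod_(s < M) \prod_(1 <= i < n.+1) stepw q u a nu N T J s i.

(* Joint probability under the mixed q-TASEP along the path (only particles
   1..N_M matter, since particle i only interacts with particle i-1) that
   x_{N_t}(N_t,T_t) + N_t = k_t for t = 0..M. *)
Definition PQ (q : R) (u a nu : nat -> R) (N T : nat -> nat) (M : nat)
    (k : 'I_M.+1 -> int) : \bar R :=
  \esum_(J in [set J : {ffun 'I_M * 'I_(N M) -> nat} |
                forall s : 'I_M.+1, pos J s (N s) + (N s)%:Z = k s])
     (tweight q u a nu N T J)%:E.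

End Defs.

(* Main.v *)
Require Import Defs.
From HB Require Import structures.
From mathcomp Require Import all_boot all_order all_algebra.
From mathcomp Require Import all_classical all_reals all_analysis.
From mathcomp Require Import ring lra zify.
Import Order.TTheory GRing.Theory Num.Theory.
Import numFieldNormedType.Exports.
Local Open Scope ring_scope.

(** Let [y_i] be the displacement [x_i + i] of particle [i] in the q-TASEP, and
    the number of arrows that left column [i] to the right in the vertex model.
    A row of the vertex model with all [nu = 0] is the Bernoulli move, so both
    processes live on the same states and only the geometric moves have to be
    explained.

    Local input: let a site perform a Bernoulli and a geometric move, in either
    order, and let [d] be its total displacement.  A stochastic 2x2 matrix [rw],
    depending only on [d] and on [kap = c / beta], exchanges the two orders.
    Pulled through a whole configuration, it shows that a geometric move
    restricted to an interval of sites commutes with a row, at the price of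
    switching [nu] on at the first site of the interval (unless it is site 1)
    and off at the site following the last one.

    Split the geometric move with parameter [c_k] into its parts on the sites
    [>= k] and on the sites [< k].  The first part commutes with everything
    observed before it (particles [< k]), is pushed to time 0 and disappears
    there, because all gaps vanish; this turns [nu] on in column [k] in the
    rows before the move.  The second part commutes with everything observed
    after it (particles [>= k]) and is pushed to the end, where only its total
    mass 1 matters; this turns [nu] on in column [k] in the rows after the move.
    What remains is the vertex model.

    All kernels only increase positions, so that the algebra takes place on
    states bounded by [L]; the bound is removed at the end with Euler's identity
    [sum_j g^j / (q;q)_j = 1 / (g;q)_oo].  On the vertex side, an arrow gets
    past one more column with probability at most [1 - eps], whence the limit
    in the number of columns. *)

Set Implicit Arguments.
Unset Strict Implicit.
Unset Printing Implicit Defensive.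

(** * Local weights and their exchange relations *)

Section LocalWeights.
Variables (R : realType) (q : R).
Hypothesis q01 : 0 < q < 1.

(** The weight [Lw] in the variable x = - a u, with [g] vertical arrows, incoming bit [b] and
    outgoing bit [o]. At nu = 0 it is the law of a Bernoulli jump across the gap [g], where [b]
    records whether the preceding particle jumped. *)
Definition bw (x nu : R) (g : nat) (b o : bool) : R :=
  match b, o with
  | false, false => (1 + x * q ^+ g) / (1 + x)
  | false, true => x * (1 - q ^+ g) / (1 + x)
  | true, true => (nu * q ^+ g + x) / (1 + x)
  | true, false => (1 - nu * q ^+ g) / (1 + x)
  end.

(** The exchange matrix. [b] is the row bit of the site when the geometric move comes first, [o] its
    row bit when the row comes first; [d] is the total displacement, common to both orders. *)
Definition rw (kap : R) (d : nat) (b o : bool) : R :=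
  match b, o with
  | false, false => (q ^+ d + kap) / (1 + kap)
  | false, true => (1 - q ^+ d) / (1 + kap)
  | true, false => kap / (1 + kap)
  | true, true => 1 / (1 + kap)
  end.

Lemma qpochS (z : R) k : qpoch z q k.+1 = qpoch z q k * (1 - z * q ^+ k).
Proof. by rewrite /qpoch big_ord_recr. Qed.

Lemma qpoch0 (z : R) : qpoch z q 0 = 1.
Proof. by rewrite /qpoch big_ord0. Qed.

Lemma expq_gt0 k : 0 < q ^+ k.
Proof. by case/andP: q01 => h _; rewrite exprn_gt0. Qed.

Lemma expq_le1 k : q ^+ k <= 1.
Proof. by case/andP: q01 => h h1; rewrite exprn_ile1 ?ltW. Qed.

Lemma qpoch_gt0 (z : R) k : z < 1 -> 0 < qpoch z q k.
Proof.
move=> z1; elim: k => [|k IH]; first by rewrite qpoch0.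
rewrite qpochS mulr_gt0 // subr_gt0.
have [z0|z0] := leP 0 z; last first.
  by apply: lt_trans ltr01; rewrite pmulr_llt0 // expq_gt0.
by apply: le_lt_trans z1; rewrite ler_piMr // expq_le1.
Qed.

Lemma qpochqq_neq0 k : qpoch q q k != 0.
Proof. by case/andP: q01 => _ h; rewrite gt_eqF // qpoch_gt0. Qed.

Lemma expqS_lt1 k : q ^+ k.+1 < 1.
Proof. by case/andP: q01 => h h1; rewrite exprn_ilt1 // ltW. Qed.

Lemma oneBqX_neq0 k : 1 - q ^+ k.+1 != 0.
Proof. by rewrite gt_eqF // subr_gt0 expqS_lt1. Qed.

Lemma pfin0 m (g : R) : pfin q m g 0 = qpoch g q m.
Proof.
rewrite /pfin leq0n expr0 mul1r subn0 qpoch0 mul1r divff ?mulr1 //.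
exact: qpochqq_neq0.
Qed.

Lemma pfin_gt m (g : R) j : (m < j)%N -> pfin q m g j = 0.
Proof. by move=> h; rewrite /pfin leqNgt h. Qed.

Lemma pfinn m (g : R) : pfin q m g m = g ^+ m.
Proof.
by rewrite /pfin leqnn subnn !qpoch0 !mulr1 divff ?mulr1 // qpochqq_neq0.
Qed.

(* Dividing by this factor turns the values of [pfin] that enter the exchange
   relations (gaps [d + e], [d + e + 1], [d + e + 2]) into polynomials in
   [q ^+ d] and [q ^+ e]. *)
Definition pfu (gam : R) d e : R :=
  gam ^+ d * qpoch gam q e * qpoch q q (d + e) /
  (qpoch q q d.+1 * qpoch q q e.+1).

Lemma pfin_pfu1 gam d e :
  pfin q (d + e).+1 gam d.+1 =
  pfu gam d e * gam * (1 - q ^+ d.+1 * q ^+ e) * (1 - q * q ^+ e).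
Proof.
rewrite /pfin ltnS leq_addr.
have -> : ((d + e).+1 - d.+1 = e)%N by lia.
rewrite /pfu !qpochS -?exprS -?exprD addSn.
have h1 := qpochqq_neq0 d; have h2 := qpochqq_neq0 e.
have h3 := oneBqX_neq0 d; have h4 := oneBqX_neq0 e.
rewrite !exprS in h3 h4 *; field.
by rewrite h1 h2 h3 h4.
Qed.

Lemma pfin_pfu2 gam d e :
  pfin q (d + e).+1 gam d =
  pfu gam d e * (1 - gam * q ^+ e) * (1 - q ^+ d.+1 * q ^+ e) *
  (1 - q ^+ d.+1).
Proof.
rewrite /pfin (_ : (d <= _)%N); last by lia.
have -> : ((d + e).+1 - d = e.+1)%N by lia.
rewrite /pfu !qpochS -?exprS -?exprD addSn.
have h1 := qpochqq_neq0 d; have h2 := qpochqq_neq0 e.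
have h3 := oneBqX_neq0 d; have h4 := oneBqX_neq0 e.
rewrite !exprS in h3 h4 *; field.
by rewrite h1 h2 h3 h4.
Qed.

Lemma pfin_pfu3 gam d e :
  pfin q (d + e).+2 gam d.+1 =
  pfu gam d e * gam * (1 - gam * q ^+ e) * (1 - q ^+ d.+1 * q ^+ e) *
  (1 - q * q ^+ d.+1 * q ^+ e).
Proof.
rewrite /pfin (_ : (d < _)%N); last by lia.
have -> : ((d + e).+2 - d.+1 = e.+1)%N by lia.
rewrite /pfu !qpochS -?exprS -?exprD addSn.
have h1 := qpochqq_neq0 d; have h2 := qpochqq_neq0 e.
have h3 := oneBqX_neq0 d; have h4 := oneBqX_neq0 e.
rewrite !exprS in h3 h4 *; field.
by rewrite h1 h2 h3 h4.
Qed.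

Lemma pfin_pfu4 gam d e :
  pfin q (d + e) gam d =
  pfu gam d e * (1 - q ^+ d.+1) * (1 - q * q ^+ e).
Proof.
rewrite /pfin leq_addr addKn.
rewrite /pfu !qpochS -?exprS -?exprD.
have h1 := qpochqq_neq0 d; have h2 := qpochqq_neq0 e.
have h3 := oneBqX_neq0 d; have h4 := oneBqX_neq0 e.
rewrite !exprS in h3 h4 *; field.
by rewrite h1 h2 h3 h4.
Qed.

Section Relations.
Variables (x kap : R).
Hypotheses (x1 : 1 + x != 0) (k1 : 1 + kap != 0).
Let gam := x * kap.

Lemma rw_sum d b : rw kap d b false + rw kap d b true = 1.
Proof. by case: b; rewrite /rw; field. Qed.

(** Site after the interval: the geometric jump [j] of its predecessor widens the gap from [g] to
    [g + j], and the matrix is absorbed by switching the parameter from [gam] to 0. *)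
Lemma rw_end g j (b o : bool) :
  rw kap (j + b) b false * bw x gam g false o +
  rw kap (j + b) b true * bw x gam g true o = bw x 0 (g + j) b o.
Proof.
case: b; case: o; rewrite /rw /bw /gam ?addn0 ?addn1 ?exprS ?exprD; field;
  by rewrite x1 k1.
Qed.

(** Interior site that does not move at all. The right-hand side sums over the bit of the preceding
    site when the row comes first. *)
Lemma rw_bulk0 g j0 (b0 : bool) :
  pfin q g gam 0 * bw x 0 (g + j0) b0 false =
  rw kap (j0 + b0) b0 false * bw x 0 g false false * pfin q g gam 0 +
  rw kap (j0 + b0) b0 true * bw x 0 g true false * pfin q g.+1 gam 0.
Proof.
rewrite !pfin0 !qpochS /gam.
case: b0; rewrite /rw /bw ?addn0 ?addn1 ?exprS ?exprD; field;
  by rewrite x1 k1.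
Qed.

(** Interior site with displacement [d.+1]. With the geometric move first, the jump is [d.+1] or
    [d], completed by the row bit 0 or 1. *)
Lemma rw_bulk g j0 d (b0 o : bool) :
  pfin q g gam d.+1 * bw x 0 (g + j0 - d.+1) b0 false * rw kap d.+1 false o +
  pfin q g gam d * bw x 0 (g + j0 - d) b0 true * rw kap d.+1 true o =
  rw kap (j0 + b0) b0 false * bw x 0 g false o * pfin q (g - o) gam (d.+1 - o) +
  rw kap (j0 + b0) b0 true * bw x 0 g true o * pfin q (g.+1 - o) gam (d.+1 - o).
Proof.
(* The generic range d < g, the edge d = g where the jump [d.+1] is impossible, and d > g where both
   sides vanish. *)
have [dg|] := ltnP d g; last rewrite leq_eqVlt => /predU1P[->|gd].
- have [e ->] : exists e, g = (d + e).+1 by exists (g - d.+1)%N; lia.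
  have -> : ((d + e).+1 + j0 - d.+1 = e + j0)%N by lia.
  have -> : ((d + e).+1 + j0 - d = (e + j0).+1)%N by lia.
  case: o; rewrite /nat_of_bool ?subn0 ?subSS ?subn0;
    rewrite pfin_pfu1 pfin_pfu2 ?pfin_pfu3 ?pfin_pfu4;
    rewrite -addSn /gam; case: b0; rewrite /rw /bw ?addn0 ?addn1 -?addSn ?(exprD, exprS);
    field; by rewrite x1 k1.
- rewrite (_ : d + j0 - d = j0)%N; last by lia.
  rewrite pfin_gt // pfinn.
  case: o; rewrite /nat_of_bool ?subn0 ?subSS ?subn0 ?pfinn.
    case: d => [|d]; rewrite ?pfinn ?[pfin q (_ - _) _ _]pfin_gt //; try lia;
    case: b0; rewrite /rw /bw /gam ?addn0 ?addn1 ?(exprD, exprS) ?expr0; try field; by rewrite ?x1 ?k1.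
  rewrite [pfin q d _ _]pfin_gt //.
  case: b0; rewrite /rw /bw /gam ?addn0 ?addn1 ?(exprD, exprS) ?expr0; field; by rewrite ?x1 ?k1.
- by rewrite !pfin_gt; [rewrite !(mul0r, mulr0, addr0)|case: (o); lia..].
Qed.

(** First site of an interval not containing site 1: no matrix arrives from the left, and the
    parameter [gam] in the row performed second compensates for it. *)
Lemma rw_start0 g (b0 : bool) :
  pfin q g gam 0 * bw x gam g b0 false =
  bw x 0 g b0 false * pfin q (g + b0) gam 0.
Proof.
rewrite !pfin0 /gam.
case: b0; rewrite ?addn0 ?addn1 ?qpochS /bw; field; by rewrite x1.
Qed.

Lemma rw_start g d (b0 o : bool) :
  pfin q g gam d.+1 * bw x gam (g - d.+1) b0 false * rw kap d.+1 false o +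
  pfin q g gam d * bw x gam (g - d) b0 true * rw kap d.+1 true o =
  bw x 0 g b0 o * pfin q (g + b0 - o) gam (d.+1 - o).
Proof.
have [dg|] := ltnP d g; last rewrite leq_eqVlt => /predU1P[->|gd].
- have [e ->] : exists e, g = (d + e).+1 by exists (g - d.+1)%N; lia.
  have -> : ((d + e).+1 - d.+1 = e)%N by lia.
  have -> : ((d + e).+1 - d = e.+1)%N by lia.
  case: o; case: b0; rewrite /nat_of_bool ?addn1 ?addn0 ?subn0 ?subSS ?subn0;
    rewrite pfin_pfu1 pfin_pfu2 ?pfin_pfu3 ?pfin_pfu4;
    rewrite -addSn /gam; rewrite /rw /bw ?addn0 ?addn1 -?addSn ?(exprD, exprS);
    field; by rewrite x1 k1.
- rewrite (_ : d - d = 0)%N; last by lia.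
  rewrite pfin_gt // pfinn.
  case: o; case: b0; rewrite /nat_of_bool ?addn1 ?addn0 ?subn0 ?subSS ?subn0 ?pfinn
     ?[pfin q d _ d.+1]pfin_gt //;
   try (case: d => [|d]; rewrite ?pfinn ?[pfin q (_ - _) _ _]pfin_gt //; try lia);
   rewrite /rw /bw /gam ?addn0 ?addn1 ?(exprD, exprS) ?expr0; try field;
   by rewrite ?x1 ?k1.
- by rewrite !pfin_gt; [rewrite !(mul0r, mulr0, addr0)|case: (o); case: (b0); lia..].
Qed.

(** Site 1 has an infinite gap: the factor [qpoch_inf gam q] is common to all terms, and the
    parameter stays 0 in both orders. *)
Lemma rw_first d (o : bool) :
  pinf q gam d.+1 * bw x 0 0 true false * rw kap d.+1 false o +
  pinf q gam d * bw x 0 0 true true * rw kap d.+1 true o =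
  bw x 0 0 true o * pinf q gam (d.+1 - o).
Proof.
rewrite /pinf; case: o; rewrite /nat_of_bool ?subn0 ?subSS ?subn0;
  rewrite /gam /bw /rw qpochS -?exprS;
  have h1 := qpochqq_neq0 d; have h2 := oneBqX_neq0 d;
  rewrite !exprS in h2 *; field; by rewrite ?x1 ?k1 ?h1 ?h2.
Qed.

End Relations.
End LocalWeights.

Arguments bw : simpl never.
Arguments rw : simpl never.

(** * Sums over bounded configurations *)

Section FiniteSums.
Variable R : realType.

Definition frcons n (T : Type) (z : {ffun 'I_n -> T}) (t : T) :
    {ffun 'I_n.+1 -> T} :=
  [ffun i => if unlift ord_max i is Some j then z j else t].

Lemma big_ffun_recr n (T : finType) (F : {ffun 'I_n.+1 -> T} -> R) :
  \sum_z F z = \sum_(z : {ffun 'I_n -> T}) \sum_(t : T) F (frcons z t).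
Proof.
rewrite pair_big (reindex (fun p : {ffun 'I_n -> T} * T => frcons p.1 p.2)) //=.
exists (fun z : {ffun 'I_n.+1 -> T} => ([ffun j => z (lift ord_max j)], z ord_max)).
  move=> [z t] _ /=; congr pair.
    by apply/ffunP => j; rewrite !ffunE liftK.
  by rewrite !ffunE unlift_none.
move=> z _; apply/ffunP => i; rewrite !ffunE /=.
by case: unliftP => [j ->|->]; rewrite ?ffunE.
Qed.

Lemma sum_one (f : nat -> R) p L : (p <= L)%N ->
  (forall t, t != p -> f t = 0) -> \sum_(t < L.+1) f t = f p.
Proof.
move=> pL h; rewrite (bigD1 (Ordinal (pL : (p < L.+1)%N))) //= big1 ?addr0 // => i.
by move=> ip; apply: h; apply: contraNneq ip => ip; apply/eqP/val_inj.
Qed.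

(** For p = L the second point lies outside the range of summation; the last hypothesis then makes
    its term vanish. *)
Lemma sum_two (f : nat -> R) p L : (p <= L)%N ->
  (forall t, t != p -> t != p.+1 -> f t = 0) ->
  ((L <= p)%N -> f p.+1 = 0) -> \sum_(t < L.+1) f t = f p + f p.+1.
Proof.
move=> pL h hL.
rewrite (bigD1 (Ordinal (pL : (p < L.+1)%N))) //=; congr (_ + _).
have [pL1|Lp] := ltnP p L; last first.
  rewrite hL // big1 // => i ip; apply: h.
    by apply: contraNneq ip => ip; apply/eqP/val_inj.
  by have := ltn_ord i; lia.
rewrite (bigD1 (Ordinal (pL1 : (p.+1 < L.+1)%N))) /=; last first.
  by apply/eqP => /(congr1 val) /=; lia.
rewrite big1 ?addr0 // => i /andP[ip ip1]; apply: h.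
  by apply: contraNneq ip => ip; apply/eqP/val_inj.
by apply: contraNneq ip1 => ip1; apply/eqP/val_inj.
Qed.

End FiniteSums.

Section States.
Variables (R : realType) (n L : nat).

Definition state := {ffun 'I_n -> 'I_L.+1}.

(* 1-based coordinates, with the junk value 0 outside [1, n]. *)
Definition ycoord m (y : {ffun 'I_m -> 'I_L.+1}) (i : nat) : nat :=
  if i is j.+1 then (if insub j is Some j' then y j' : nat else 0%N) else 0%N.

Arguments ycoord m y i : simpl never.

Lemma ycoordS m (y : {ffun 'I_m -> 'I_L.+1}) (i : 'I_m) : ycoord y i.+1 = y i.
Proof. by rewrite /ycoord; case: insubP => [j _ /val_inj->//|]; rewrite ltn_ord. Qed.

Lemma ycoord_le m (y : {ffun 'I_m -> 'I_L.+1}) i : (ycoord y i <= L)%N.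
Proof. by case: i => // i; rewrite /ycoord; case: insubP => // j _ _; rewrite -ltnS. Qed.

Lemma ycoord_out m (y : {ffun 'I_m -> 'I_L.+1}) i : (m < i)%N -> ycoord y i = 0%N.
Proof. by case: i => // i im; rewrite /ycoord insubF //; lia. Qed.

Lemma ycoord_inj m (y z : {ffun 'I_m -> 'I_L.+1}) :
  (forall i, (0 < i <= m)%N -> ycoord y i = ycoord z i) -> y = z.
Proof.
move=> h; apply/ffunP => i; apply/val_inj => /=.
by have := h i.+1; rewrite !ycoordS; apply; rewrite /= ltn_ord.
Qed.

Lemma ycoord_outside m (y : {ffun 'I_m -> 'I_L.+1}) i : ~~ (0 < i <= m)%N -> ycoord y i = 0%N.
Proof. by case: i => // i h; rewrite ycoord_out //; lia. Qed.

Lemma ycoord_funinj m (y z : {ffun 'I_m -> 'I_L.+1}) : ycoord y = ycoord z -> y = z.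
Proof. by move=> h; apply: ycoord_inj => i _; rewrite h. Qed.

Lemma ycoord_frcons m (y : {ffun 'I_m -> 'I_L.+1}) t i : (i <= m)%N ->
  ycoord (frcons y t) i = ycoord y i.
Proof.
case: i => // i im; rewrite /ycoord; case: insubP => [j _ ji|]; last by lia.
case: insubP => [j' _ ji'|]; last by rewrite im.
rewrite ffunE; case: unliftP => [k jk|jk].
  suff -> : k = j' by []; apply/val_inj; rewrite /= -(lift_max k) -jk ji' ji.
all: by move: ji; rewrite ?jk /=; lia.
Qed.

Lemma ycoord_frcons_last m (y : {ffun 'I_m -> 'I_L.+1}) (t : 'I_L.+1) :
  ycoord (frcons y t) m.+1 = t.
Proof. by rewrite (ycoordS _ ord_max) ffunE unlift_none. Qed.

(** Transfer-matrix partition function of the first [k] sites, with value 0 at site 0 and [t] at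
    site [k]. *)
Fixpoint chain (w : nat -> nat -> nat -> R) (k : nat) (t : nat) : R :=
  if k is k'.+1 then \sum_(s < L.+1) chain w k' s * w k' s t else (t == 0%N)%:R.

Lemma sum_chain (w : nat -> nat -> nat -> R) m (phi : nat -> R) :
  \sum_(z : {ffun 'I_m -> 'I_L.+1})
     (\prod_(i < m) w i (ycoord z i) (ycoord z i.+1)) * phi (ycoord z m) =
  \sum_(t < L.+1) chain w m t * phi t.
Proof.
elim: m phi => [|m IH] phi.
  rewrite (@sum_one R (fun t => (t == 0%N)%:R * phi t) 0) //; last first.
    by move=> t /negbTE ->; rewrite mul0r.
  rewrite eqxx mul1r (big_pred1 [ffun i => ord0]) /= ?big_ord0 ?mul1r // => z.
  by rewrite /=; symmetry; apply/eqP/ffunP => -[].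
rewrite big_ffun_recr /=.
under eq_bigr => z _.
  under eq_bigr => t _.
    rewrite big_ord_recr /= ycoord_frcons_last ycoord_frcons //.
    under eq_bigr => i _ do
      rewrite (ycoord_frcons z t (ltnW (ltn_ord i))) (ycoord_frcons z t (ltn_ord i)).
    rewrite -!mulrA; over.
  rewrite -mulr_sumr; over.
rewrite /= (IH (fun s => \sum_(t < L.+1) w m s t * phi t)) /=.
under eq_bigr => s _ do rewrite mulr_sumr.
rewrite exchange_big /=; apply: eq_bigr => t _; rewrite mulr_suml.
by apply: eq_bigr => s _; rewrite mulrA.
Qed.

(* The zipper: [r k] moves the discrepancy between the two chains across
   the [k]-th site. *)
Lemma chain_zipper (w w' r : nat -> nat -> nat -> R) (P : nat -> nat -> bool) m :
  P 0%N 0%N -> (forall t, r 0%N 0%N t = (t == 0%N)%:R) ->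
  (forall k s t, (k < m)%N -> (s <= L)%N -> (t <= L)%N -> P k s -> ~~ P k.+1 t -> w' k s t = 0) ->
  (forall k s t, (k < m)%N -> (s <= L)%N -> (t <= L)%N -> P k s ->
    \sum_(t' < L.+1) w' k s t' * r k.+1 t' t = \sum_(t' < L.+1) r k s t' * w k t' t) ->
  (forall s, (s <= L)%N -> P m s -> \sum_(t < L.+1) r m s t = 1) ->
  \sum_(t < L.+1) chain w m t = \sum_(t < L.+1) chain w' m t.
Proof.
move=> P0 r0 hP hr r1.
(* [P k] contains the support of the chain of [w'], so the exchange relation is required only
   there. *)
have chP k t : (k <= m)%N -> (t <= L)%N -> ~~ P k t -> chain w' k t = 0.
  elim: k t => [|k IH] t km tL nP /=.
    by case: eqP => // t0; rewrite t0 P0 in nP.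
  apply: big1 => s _; case: (boolP (P k s)) => hs.
    by rewrite hP ?mulr0 ?leq_ord.
  by rewrite IH ?mul0r ?leq_ord // ltnW.
(* The invariant of the zipper; at k = m the row sums of [r m] are 1 and the matrix disappears. *)
have chE k t : (k <= m)%N -> (t <= L)%N ->
    chain w k t = \sum_(s < L.+1) chain w' k s * r k s t.
  elim: k t => [|k IH] t km tL.
    rewrite (@sum_one R (fun s => chain w' 0 s * r 0%N s t) 0) //=.
      by rewrite mul1r r0.
    by move=> s /negbTE ->; rewrite mul0r.
  rewrite /=.
  under eq_bigr => s _ do rewrite (IH _ (ltnW km) (leq_ord s)) mulr_suml.
  rewrite exchange_big /=.
  under [RHS]eq_bigr => s _ do rewrite mulr_suml.
  rewrite [RHS]exchange_big /=; apply: eq_bigr => s _.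
  under eq_bigr => i _ do rewrite -mulrA.
  under [RHS]eq_bigr => i _ do rewrite -mulrA.
  rewrite -!mulr_sumr; case: (boolP (P k s)) => hs.
    by rewrite hr ?leq_ord.
  by rewrite chP ?mul0r ?leq_ord // ltnW.
under eq_bigr => t _ do rewrite (chE _ _ (leqnn m) (leq_ord t)).
rewrite exchange_big /=; apply: eq_bigr => s _.
rewrite -mulr_sumr; case: (boolP (P m s)) => hs.
  by rewrite r1 ?mulr1 ?leq_ord.
by rewrite chP ?mul0r ?leq_ord.
Qed.

End States.

Arguments ycoord : simpl never.

(** * The exchange of a row and a geometric move *)

Section Kernels.
Variables (R : realType) (q : R) (n L : nat).
Hypothesis q01 : 0 < q < 1.

Local Notation state := (state n L).

(* [i] is the site, [yp] and [y] the positions at sites [i - 1] and [i] before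
   the move, [yp'] and [y'] after it; site 1 sees [yp = 0], so that its truncated
   gap [yp - y] is 0. *)
Definition vsite (x nu : nat -> R) (i yp y yp' y' : nat) : R :=
  let b := (i == 1%N) || (yp' == yp.+1) in
  if y' == y then bw q (x i) (nu i) (yp - y) b false
  else if y' == y.+1 then bw q (x i) (nu i) (yp - y) b true else 0.

Definition gsite (gam : nat -> R) (A : pred nat) (i yp y y' : nat) : R :=
  if A i then
    if (y <= y')%N then
      if i == 1%N then pinf q (gam i) (y' - y)
      else pfin q (yp - y) (gam i) (y' - y)
    else 0
  else (y' == y)%:R.

Definition vker x nu (y z : state) : R :=
  \prod_(i < n) vsite x nu i.+1 (ycoord y i) (ycoord y i.+1) (ycoord z i) (ycoord z i.+1).

Definition gker gam A (y z : state) : R :=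
  \prod_(i < n) gsite gam A i.+1 (ycoord y i) (ycoord y i.+1) (ycoord z i.+1).

(** In the positions x_i = y_i - i this is the exclusion constraint, the gap x_(i-1) - x_i - 1 being
    y_(i-1) - y_i. *)
Definition ordered (y : state) := forall i, (0 < i)%N -> (ycoord y i.+1 <= ycoord y i)%N.

Section Exchange.
Variables (x nu nu' : nat -> R) (kap : R) (A : pred nat).
Hypotheses (x1 : forall i, (0 < i)%N -> 1 + x i != 0) (k1 : 1 + kap != 0).
Let gam i := x i * kap.
Hypothesis A0 : ~~ A 0%N.
Hypothesis nu_in : forall i, A i -> nu i = 0.
Hypothesis nu'_first : A 1%N -> nu' 1%N = 0.
Hypothesis nu'_in : forall i, A i.+2 -> A i.+1 -> nu' i.+2 = 0.
Hypothesis nu'_start : forall i, A i.+2 -> ~~ A i.+1 -> nu' i.+2 = gam i.+2.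
Hypothesis nu_end : forall i, A i.+1 -> ~~ A i.+2 -> nu i.+2 = gam i.+2.
Hypothesis nu'_end : forall i, A i.+1 -> ~~ A i.+2 -> nu' i.+2 = 0.
Hypothesis nu_out : forall i, ~~ A i -> ~~ A i.+1 -> nu i.+1 = nu' i.+1.

(** [y] and [y'] are the initial and final positions of site [k]; [t] and [t''] are its intermediate
    positions with the geometric move first and with the row first. Outside [A] only the row acts,
    whence t = y and t'' = y'. *)
Let rsite (k y y' t t'' : nat) : R :=
  if A k then
    if t'' == y then rw q kap (y' - y) (y' == t.+1) false
    else if t'' == y.+1 then rw q kap (y' - y) (y' == t.+1) true else 0
  else (t'' == y')%:R.

(** What a nonzero weight forces when the geometric move comes first. *)
Let psite (k y y' t : nat) : bool :=
  ((y' == t) || (y' == t.+1)) && (if A k then (y <= t)%N else t == y).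

Let wBG k yp y y' t t' := vsite x nu k.+1 yp y t t' * gsite gam A k.+1 t t' y'.
Let wGB k yp y yp' y' t t' := gsite gam A k.+1 yp y t' * vsite x nu' k.+1 t t' yp' y'.

Lemma rsite_sum k y y' t : (y <= L)%N -> (y' <= L)%N -> psite k y y' t ->
  \sum_(t'' < L.+1) rsite k y y' t t'' = 1.
Proof.
move=> yL y'L; rewrite /psite => /andP[yt hy]; rewrite /rsite.
case: (boolP (A k)) hy => Ak hy; last first.
  rewrite (@sum_one R (fun t => (t == y')%:R) y') ?eqxx //.
  by move=> s /negbTE->.
rewrite (@sum_two R (fun t'' => if t'' == y then _ else if t'' == y.+1 then _ else 0) y) //.
- by rewrite !eqxx (gtn_eqF (ltnSn y)) rw_sum.
- by move=> s /negbTE-> /negbTE->.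
(* At the truncation level the target [y.+1] is missing, but the displacement is then 0 and the
   matrix gives that target weight 0. *)
rewrite (gtn_eqF (ltnSn y)) eqxx => Ly; have -> : y' = y by lia.
by rewrite /rw subnn expr0 subrr mul0r (_ : (_ == _) = false) //; lia.
Qed.

Lemma wGB_psite k yp y yp' y' s t : ~~ psite k.+1 y y' t -> wGB k yp y yp' y' s t = 0.
Proof.
rewrite /psite negb_and /wGB /gsite /vsite => /orP[|].
  by rewrite negb_or => /andP[/negbTE-> /negbTE->]; rewrite mulr0.
case: ifP => _; first by move=> /negbTE ->; rewrite mul0r.
by move=> /negbTE->; rewrite mul0r.
Qed.

Lemma site_out k yp y yp' y' s t :
  (yp <= L)%N -> (yp' <= L)%N -> (y <= L)%N -> (y' <= L)%N -> psite k yp yp' s ->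
  ~~ A k -> ~~ A k.+1 ->
  \sum_(t' < L.+1) wGB k yp y yp' y' s t' * rsite k.+1 y y' t' t =
  \sum_(t' < L.+1) rsite k yp yp' s t' * wBG k yp y y' t' t.
Proof.
move=> ypL yp'L yL y'L; rewrite /psite => /andP[hp hs] Ak Ak1.
rewrite (negbTE Ak) in hs; rewrite (eqP hs) in hp *.
rewrite (@sum_one R (fun t' => wGB k yp y yp' y' yp t' * rsite k.+1 y y' t' t) y) //; last first.
  by move=> u uy; rewrite /wGB /gsite (negbTE Ak1) (negbTE uy) !mul0r.
rewrite (@sum_one R (fun t' => rsite k yp yp' yp t' * wBG k yp y y' t' t) yp') //; last first.
  by move=> u uy; rewrite /rsite (negbTE Ak) (negbTE uy) !mul0r.
rewrite /wGB /wBG /gsite /rsite (negbTE Ak) (negbTE Ak1) !eqxx !mul1r eq_sym.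
rewrite /vsite nu_out //; case: (eqVneq t y') => [->|]; first by [].
by rewrite !mulr0.
Qed.

Lemma site_end k yp y yp' y' s t :
  (yp <= L)%N -> (yp' <= L)%N -> (y <= L)%N -> (y' <= L)%N -> psite k yp yp' s ->
  (y <= yp)%N -> A k -> ~~ A k.+1 ->
  \sum_(t' < L.+1) wGB k yp y yp' y' s t' * rsite k.+1 y y' t' t =
  \sum_(t' < L.+1) rsite k yp yp' s t' * wBG k yp y y' t' t.
Proof.
move=> ypL yp'L yL y'L; rewrite /psite => /andP[hp hs] yyp Ak Ak1.
case: k Ak Ak1 hs => [|k] Ak Ak1 hs; first by move: (A0); rewrite Ak.
rewrite Ak in hs.
rewrite (@sum_one R (fun t' => wGB k.+1 yp y yp' y' s t' * rsite k.+2 y y' t' t) y) //; last first.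
  by move=> u uy; rewrite /wGB /gsite (negbTE Ak1) (negbTE uy) !mul0r.
(* The predecessor is displaced by its geometric jump plus its row bit, the form [j + b] of
   [rw_end]. *)
have hd : (yp' - yp = (s - yp) + (yp' == s.+1))%N.
  by case/orP: hp => /eqP ->; lia.
rewrite (@sum_two R (fun t' => rsite k.+1 yp yp' s t' * wBG k.+1 yp y y' t' t) yp) //; first last.
- move=> Lyp; rewrite /rsite Ak (gtn_eqF (ltnSn yp)) eqxx.
  have -> : yp' = yp by lia.
  rewrite /rw subnn expr0 subrr mul0r (_ : (_ == _) = false) ?mul0r //.
  by lia.
- by move=> u /negbTE uy /negbTE uy1; rewrite /rsite Ak uy uy1 mul0r.
rewrite /rsite Ak (negbTE Ak1) !eqxx (gtn_eqF (ltnSn yp)) hd.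
rewrite /wGB /wBG /gsite (negbTE Ak1) eqxx mul1r [y' == t]eq_sym.
case: (eqVneq t y') => [->|]; last by rewrite !mulr0 addr0.
rewrite !mulr1 /vsite eqxx /= nu_end // nu'_end //.
rewrite (_ : (s - y = (yp - y) + (s - yp))%N); last by lia.
have E := rw_end q (x1 (ltn0Sn k.+1)) k1 (yp - y) (s - yp) (yp' == s.+1).
rewrite (ltn_eqF (ltnSn yp)).
by case: eqP => _; [rewrite -E|case: eqP => _; [rewrite -E|rewrite !mulr0 addr0]].
Qed.

Let gw i g j := if i == 1%N then pinf q (gam i) j else pfin q g (gam i) j.

Lemma lhs_lt k yp y yp' y' s t : A k.+1 -> (y' < y)%N ->
  \sum_(t' < L.+1) wGB k yp y yp' y' s t' * rsite k.+1 y y' t' t = 0.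
Proof.
move=> Ak yy; apply: big1 => u _; rewrite wGB_psite ?mul0r // /psite Ak.
by apply/negP; lia.
Qed.

(** Without displacement the matrix is used at d = 0 and bit 0, where it is deterministic; hence the
    factor in [~~ o]. *)
Lemma lhs_eq k yp y yp' s (o : bool) : A k.+1 -> (y <= L)%N ->
  \sum_(t' < L.+1) wGB k yp y yp' y s t' * rsite k.+1 y y t' (y + o) =
  gw k.+1 (yp - y) 0 *
    bw q (x k.+1) (nu' k.+1) (s - y) ((k == 0%N) || (yp' == s.+1)) false * (~~ o)%:R.
Proof.
move=> Ak yL.
rewrite (@sum_one R (fun t' => wGB k yp y yp' y s t' * rsite k.+1 y y t' (y + o)%N) y) //; last first.
  move=> u uy; rewrite wGB_psite ?mul0r // /psite Ak.
  by apply/negP; lia.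
rewrite /wGB /gsite /vsite /rsite Ak leqnn !eqxx /gw !subnn (ltn_eqF (ltnSn y)) eqSS.
congr (_ * _ * _).
case: o; rewrite /nat_of_bool ?addn0 ?addn1 ?eqxx ?(gtn_eqF (ltnSn y)) /rw expr0.
  by rewrite subrr mul0r.
by rewrite divff.
Qed.

(** Two routes lead to the displacement [d.+1]: jump by [d.+1] and stay in the row, or jump by [d]
    and move by one in the row. *)
Lemma lhs_gt k yp y yp' d s (o : bool) : A k.+1 -> (y + d.+1 <= L)%N ->
  \sum_(t' < L.+1) wGB k yp y yp' (y + d.+1) s t' * rsite k.+1 y (y + d.+1) t' (y + o) =
  gw k.+1 (yp - y) d.+1 *
    bw q (x k.+1) (nu' k.+1) (s - (y + d.+1)) ((k == 0%N) || (yp' == s.+1)) false *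
    rw q kap d.+1 false o +
  gw k.+1 (yp - y) d *
    bw q (x k.+1) (nu' k.+1) (s - (y + d)) ((k == 0%N) || (yp' == s.+1)) true *
    rw q kap d.+1 true o.
Proof.
move=> Ak yL.
rewrite (@sum_two R (fun t' => wGB k yp y yp' (y + d.+1) s t' *
    rsite k.+1 y (y + d.+1) t' (y + o)%N) (y + d)); first last.
- by lia.
- move=> u uy uy1; rewrite wGB_psite ?mul0r // /psite Ak.
  by apply/negP; lia.
- by lia.
rewrite addrC /wGB /gsite /vsite /rsite Ak !addnS !eqxx !eqSS.
rewrite (gtn_eqF (ltnSn (y + d))) (ltn_eqF (ltnSn (y + d))).
rewrite -addnS !addKn !leq_addr.
by case: o; rewrite /nat_of_bool ?addn0 ?addn1 ?eqxx ?(gtn_eqF (ltnSn y)).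
Qed.

Lemma lhs_other k yp y yp' y' s t : A k.+1 -> t != y -> t != y.+1 ->
  \sum_(t' < L.+1) wGB k yp y yp' y' s t' * rsite k.+1 y y' t' t = 0.
Proof.
move=> Ak ty ty1; apply: big1 => u _.
by rewrite /rsite Ak (negbTE ty) (negbTE ty1) mulr0.
Qed.

Lemma rhs_other k yp y y' t t' : t' != y -> t' != y.+1 ->
  wBG k yp y y' t t' = 0.
Proof. by move=> ty ty1; rewrite /wBG /vsite (negbTE ty) (negbTE ty1) mul0r. Qed.

Lemma rhsE k yp y y' t (o : bool) : A k.+1 ->
  wBG k yp y y' t (y + o) =
  bw q (x k.+1) 0 (yp - y) ((k == 0%N) || (t == yp.+1)) o *
  (if (y + o <= y')%N then gw k.+1 (t - (y + o)) (y' - (y + o)) else 0).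
Proof.
move=> Ak; rewrite /wBG /vsite /gsite Ak nu_in // eqSS /gw.
by case: o; rewrite /nat_of_bool ?addn0 ?addn1 ?eqxx ?(gtn_eqF (ltnSn y)).
Qed.

Lemma site_first y y' t :
  (y <= L)%N -> (y' <= L)%N -> (t <= L)%N -> A 1%N ->
  \sum_(t' < L.+1) wGB 0 0 y 0 y' 0 t' * rsite 1 y y' t' t =
  \sum_(t' < L.+1) rsite 0 0 0 0 t' * wBG 0 0 y y' t' t.
Proof.
move=> yL y'L tL A1.
rewrite [RHS](@sum_one R (fun t' => rsite 0 0 0 0 t' * wBG 0 0 y y' t' t) 0) //; last first.
  by move=> u u0; rewrite /rsite (negbTE A0) (negbTE u0) mul0r.
rewrite {2}/rsite (negbTE A0) eqxx mul1r.
have [] : (exists o : bool, t = y + o)%N \/ (t != y /\ t != y.+1).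
- case: (eqVneq t y) => [->|ty]; first by left; exists false; rewrite addn0.
  case: (eqVneq t y.+1) => [->|ty1]; first by left; exists true; rewrite addn1.
  by right.
- move=> [] o ->; rewrite rhsE //; have [yy'|] := ltnP y' y.
    have -> : (y + o <= y')%N = false by lia.
    by rewrite lhs_lt // mulr0.
  rewrite leq_eqVlt => /predU1P[<-|yy'].
    rewrite lhs_eq // nu'_first // /gw /= sub0n.
    case: (o); rewrite /= ?mulr0 ?addn0 ?addn1 ?ltnn ?leqnn ?mulr0 ?subnn ?mulr1 //.
    by rewrite mulrC.
  have [d y'd] : exists d, y' = (y + d.+1)%N by exists (y' - y).-1; lia.
  rewrite y'd lhs_gt //; last by lia.
  have -> : (y + o <= y + d.+1)%N by case: (o); lia.
  rewrite nu'_first // !sub0n /=.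
  rewrite /gw /= rw_first //; last exact: x1.
  by congr (_ * pinf _ _ _); case: (o); lia.
- by move=> [ty ty1]; rewrite lhs_other // rhs_other.
Qed.

Lemma site_start k yp y yp' y' s t :
  (yp <= L)%N -> (yp' <= L)%N -> (y <= L)%N -> (y' <= L)%N -> (t <= L)%N ->
  psite k.+1 yp yp' s -> (y <= yp)%N -> ~~ A k.+1 -> A k.+2 ->
  \sum_(t' < L.+1) wGB k.+1 yp y yp' y' s t' * rsite k.+2 y y' t' t =
  \sum_(t' < L.+1) rsite k.+1 yp yp' s t' * wBG k.+1 yp y y' t' t.
Proof.
move=> ypL yp'L yL y'L tL; rewrite /psite => /andP[hp hs] yyp Ak Ak1.
rewrite (negbTE Ak) in hs; rewrite (eqP hs) in hp *.
rewrite [RHS](@sum_one R (fun t' => rsite k.+1 yp yp' yp t' * wBG k.+1 yp y y' t' t) yp') //; last first.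
  by move=> u u0; rewrite /rsite (negbTE Ak) (negbTE u0) mul0r.
rewrite {2}/rsite (negbTE Ak) eqxx mul1r.
(* The predecessor is outside the interval and moves by its row bit only. *)
have yp'E : yp' = (yp + (yp' == yp.+1))%N by case/orP: hp => /eqP->; lia.
have [] : (exists o : bool, t = y + o)%N \/ (t != y /\ t != y.+1).
- case: (eqVneq t y) => [->|ty]; first by left; exists false; rewrite addn0.
  case: (eqVneq t y.+1) => [->|ty1]; first by left; exists true; rewrite addn1.
  by right.
- move=> [] o ->; rewrite rhsE //; have [yy'|] := ltnP y' y.
    have -> : (y + o <= y')%N = false by lia.
    by rewrite lhs_lt // mulr0.
  rewrite leq_eqVlt => /predU1P[<-|yy'].
    rewrite lhs_eq // nu'_start // /gw /=.
    case: (o); rewrite /= ?mulr0 ?addn0 ?addn1 ?ltnn ?leqnn ?mulr0 ?subnn ?mulr1 //.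
    rewrite rw_start0 //; last exact: x1.
    by congr (_ * pfin _ _ _ _); rewrite {2}yp'E; lia.
  have [d y'd] : exists d, y' = (y + d.+1)%N by exists (y' - y).-1; lia.
  rewrite y'd lhs_gt //; last by lia.
  have -> : (y + o <= y + d.+1)%N by case: (o); lia.
  rewrite nu'_start // !subnDA /=.
  rewrite /gw /= rw_start //; last exact: x1.
  by congr (_ * pfin _ _ _ _); rewrite 1?{2}yp'E; case: (o); lia.
- by move=> [ty ty1]; rewrite lhs_other // rhs_other.
Qed.

Lemma site_bulk k yp y yp' y' s t :
  (yp <= L)%N -> (yp' <= L)%N -> (y <= L)%N -> (y' <= L)%N -> (t <= L)%N ->
  psite k.+1 yp yp' s -> (y <= yp)%N -> A k.+1 -> A k.+2 ->
  \sum_(t' < L.+1) wGB k.+1 yp y yp' y' s t' * rsite k.+2 y y' t' t =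
  \sum_(t' < L.+1) rsite k.+1 yp yp' s t' * wBG k.+1 yp y y' t' t.
Proof.
move=> ypL yp'L yL y'L tL; rewrite /psite => /andP[hp hs] yyp Ak Ak1.
rewrite Ak in hs.
have hd : (yp' - yp = (s - yp) + (yp' == s.+1))%N.
  by case/orP: hp => /eqP ->; lia.
rewrite [RHS](@sum_two R (fun t' => rsite k.+1 yp yp' s t' * wBG k.+1 yp y y' t' t) yp) //; first last.
- move=> Lyp; rewrite /rsite Ak (gtn_eqF (ltnSn yp)) eqxx.
  have -> : yp' = yp by lia.
  rewrite /rw subnn expr0 subrr mul0r (_ : (_ == _) = false) ?mul0r //.
  by lia.
- by move=> u /negbTE uy /negbTE uy1; rewrite /rsite Ak uy uy1 mul0r.
rewrite {2 3}/rsite Ak !eqxx (gtn_eqF (ltnSn yp)) hd.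
have [] : (exists o : bool, t = y + o)%N \/ (t != y /\ t != y.+1).
- case: (eqVneq t y) => [->|ty]; first by left; exists false; rewrite addn0.
  case: (eqVneq t y.+1) => [->|ty1]; first by left; exists true; rewrite addn1.
  by right.
- move=> [] o ->; rewrite !rhsE // eqxx (ltn_eqF (ltnSn yp)) /=; have [yy'|] := ltnP y' y.
    have -> : (y + o <= y')%N = false by lia.
    by rewrite lhs_lt // !mulr0 addr0.
  have sE : (s = yp + (s - yp))%N by lia.
  rewrite leq_eqVlt => /predU1P[<-|yy'].
    rewrite lhs_eq // nu'_in // /gw /=.
    case: (o); rewrite /= ?mulr0 ?addn0 ?addn1 ?ltnn ?leqnn ?mulr0 ?addr0 ?subnn ?mulr1 //.
    have -> : (s - y = (yp - y) + (s - yp))%N by lia.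
    rewrite (rw_bulk0 q01 (x1 (ltn0Sn _)) k1) -!mulrA subSn //.
  have [d y'd] : exists d, y' = (y + d.+1)%N by exists (y' - y).-1; lia.
  rewrite y'd lhs_gt //; last by lia.
  have -> : (y + o <= y + d.+1)%N by case: (o); lia.
  rewrite nu'_in // /gw /=.
  have -> : (s - (y + d.+1) = (yp - y) + (s - yp) - d.+1)%N by lia.
  have -> : (s - (y + d) = (yp - y) + (s - yp) - d)%N by lia.
  rewrite (rw_bulk q01 (x1 (ltn0Sn _)) k1) -!mulrA.
  have -> : (yp - y - o = yp - (y + o))%N by lia.
  have -> : ((yp - y).+1 - o = yp.+1 - (y + o))%N by lia.
  by have -> : (d.+1 - o = y + d.+1 - (y + o))%N by case: (o); lia.
- by move=> [ty ty1]; rewrite lhs_other // !rhs_other // !mulr0 addr0.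
Qed.

(** [nu] belongs to the row performed before the geometric move, [nu'] to the row performed after
    it. Both sides are chains of site weights, so the zipper applies; the local relation at site k +
    1 depends on which of k and k + 1 lie in [A]. *)
Lemma vker_gker (y y' : state) : ordered y ->
  \sum_z vker x nu y z * gker gam A z y' = \sum_z gker gam A y z * vker x nu' z y'.
Proof.
move=> yo.
have E1 := @sum_chain R L (fun k => wBG k (ycoord y k) (ycoord y k.+1) (ycoord y' k.+1)) n (fun=> 1).
have E2 := @sum_chain R L (fun k => wGB k (ycoord y k) (ycoord y k.+1) (ycoord y' k) (ycoord y' k.+1)) n (fun=> 1).
transitivity (\sum_(t < L.+1) chain L (fun k => wBG k (ycoord y k) (ycoord y k.+1) (ycoord y' k.+1)) n t).
  under [RHS]eq_bigr => t _ do rewrite -[chain _ _ _ _]mulr1.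
  rewrite -E1; apply: eq_bigr => z _; rewrite mulr1 -big_split /=.
  by apply: eq_bigr => i _.
rewrite (@chain_zipper _ L _ (fun k => wGB k (ycoord y k) (ycoord y k.+1) (ycoord y' k) (ycoord y' k.+1))
   (fun k => rsite k (ycoord y k) (ycoord y' k)) (fun k => psite k (ycoord y k) (ycoord y' k))).
- under eq_bigr => t _ do rewrite -[chain _ _ _ _]mulr1.
  rewrite -E2; apply: eq_bigr => z _; rewrite mulr1 -big_split /=.
  by apply: eq_bigr => i _.
- by rewrite /psite (negbTE A0).
- by move=> t; rewrite /rsite (negbTE A0).
- by move=> k s t _ _ _ _ h; rewrite wGB_psite.
- move=> k s t kn sL tL Ps.
  have h1 := ycoord_le y k; have h2 := ycoord_le y k.+1.
  have h3 := ycoord_le y' k; have h4 := ycoord_le y' k.+1.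
  case: (boolP (A k)) => Ak; case: (boolP (A k.+1)) => Ak1.
  + case: k {kn} Ak Ak1 Ps h1 h2 h3 h4 => [|k] Ak Ak1 Ps h1 h2 h3 h4.
      by move: (A0); rewrite Ak.
    by apply: site_bulk => //; apply: yo.
  + case: k {kn} Ak Ak1 Ps h1 h2 h3 h4 => [|k] Ak Ak1 Ps h1 h2 h3 h4.
      by move: (A0); rewrite Ak.
    by apply: site_end => //; apply: yo.
  + case: k {kn} Ak Ak1 Ps h1 h2 h3 h4 => [|k] Ak Ak1 Ps h1 h2 h3 h4.
      move: Ps; rewrite /psite (negbTE A0) => /andP[_ /eqP ->].
      exact: site_first.
    by apply: site_start => //; apply: yo.
  + exact: site_out.
- by move=> s sL Ps; apply: rsite_sum => //; apply: ycoord_le.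
Qed.

End Exchange.
End Kernels.

(** * Vectors of weights *)

Section Vectors.
Variables (R : realType) (q : R) (n L : nat).
Hypothesis q01 : 0 < q < 1.

Local Notation state := (state n L).
Implicit Types (p : state -> R) (y z w : state).

Definition act p (K : state -> state -> R) : state -> R :=
  fun z => \sum_y p y * K y z.

(** Restriction without normalization: the joint probability of a list of observed values is the
    mass that remains after all restrictions. *)
Definition obs (i : nat) (v : int) p : state -> R :=
  fun y => ((ycoord y i)%:Z == v)%:R * p y.

Definition ordsupp p := forall y, p y != 0 -> ordered y.

Lemma act_act p K1 K2 z :
  act (act p K1) K2 z = \sum_y p y * \sum_w K1 y w * K2 w z.
Proof.
rewrite /act; under eq_bigr => w _ do rewrite mulr_suml.
rewrite exchange_big /=; apply: eq_bigr => y _; rewrite mulr_sumr.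
by apply: eq_bigr => w _; rewrite mulrA.
Qed.

Lemma act_exchange p K1 K2 K3 K4 : ordsupp p ->
  (forall y z, ordered y -> \sum_w K1 y w * K2 w z = \sum_w K3 y w * K4 w z) ->
  act (act p K1) K2 = act (act p K3) K4.
Proof.
move=> op h; apply/funext => z; rewrite !act_act; apply: eq_bigr => y _.
have [->|py] := eqVneq (p y) 0; first by rewrite !mul0r.
by rewrite h //; apply: op.
Qed.

Lemma ordsupp_obs i v p : ordsupp p -> ordsupp (obs i v p).
Proof. by move=> op y; rewrite /obs mulf_eq0 negb_or => /andP[_]; apply: op. Qed.

Lemma ordsupp_act p (K : state -> state -> R) :
  (forall y z, ordered y -> K y z != 0 -> ordered z) -> ordsupp p -> ordsupp (act p K).
Proof.
move=> hK op z; rewrite /act => h.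
have [y] : exists y, p y * K y z != 0.
  apply: contrapT => nh; move/negP: h; apply; apply/eqP/big1 => y _.
  by apply: contrapT => h; apply: nh; exists y; apply/eqP.
by rewrite mulf_eq0 negb_or => /andP[py Ky]; apply: hK Ky; apply: op.
Qed.

Lemma gsite_ge gam A i yp (y y' : nat) : gsite q gam A i yp y y' != 0 -> (y <= y')%N.
Proof.
rewrite /gsite; case: ifP => _; first by case: ifP => // _; rewrite eqxx.
by case: (eqVneq y' y) => [->//|_]; rewrite eqxx.
Qed.

Lemma gsite_le gam A i yp (y y' : nat) : (y <= yp)%N -> i != 1%N ->
  gsite q gam A i yp y y' != 0 -> (y' <= yp)%N.
Proof.
move=> yyp /negbTE i1; rewrite /gsite i1; case: ifP => _; last first.
  by case: (eqVneq y' y) => [->//|_]; rewrite eqxx.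
case: ifP => // yy'; last by rewrite eqxx.
have [|lt] := leqP (y' - y) (yp - y); first by lia.
by rewrite pfin_gt // eqxx.
Qed.

Lemma prod_neq0 (I : finType) (F : I -> R) : \prod_i F i != 0 -> forall i, F i != 0.
Proof. by move=> /prodf_neq0 h i; apply: h. Qed.

Lemma gker_ge gam A y z : gker q gam A y z != 0 ->
  forall i, (ycoord y i <= ycoord z i)%N.
Proof.
move=> /prod_neq0 h [|i]; first by [].
have [i_n|] := ltnP i n; last by move=> ?; rewrite !ycoord_out.
by have := h (Ordinal i_n); apply: gsite_ge.
Qed.

Lemma gker_ordered gam A y z : ordered y -> gker q gam A y z != 0 -> ordered z.
Proof.
move=> oy h i i0; have hge := gker_ge h.
have [i_n|] := ltnP i n; last by move=> ?; rewrite ycoord_out.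
have := prod_neq0 h (Ordinal i_n) => /= /gsite_le h1.
by apply: leq_trans (hge i); apply: h1; [apply: oy|lia].
Qed.

Lemma vsite_ge x nu i yp (y yp' y' : nat) : vsite q x nu i yp y yp' y' != 0 -> (y <= y')%N.
Proof.
rewrite /vsite; case: (eqVneq y' y) => [->//|_].
by case: (eqVneq y' y.+1) => [->//|_]; rewrite eqxx.
Qed.

Lemma vker_ge x nu y z : vker q x nu y z != 0 ->
  forall i, (ycoord y i <= ycoord z i)%N.
Proof.
move=> /prod_neq0 h [|i]; first by [].
have [i_n|] := ltnP i n; last by move=> ?; rewrite !ycoord_out.
by have := h (Ordinal i_n); apply: vsite_ge.
Qed.

(** Order can only break at a zero gap, where a site moves only together with its predecessor
    because 1 - q^0 = 0. *)
Lemma vker_ordered x nu y z : ordered y -> vker q x nu y z != 0 -> ordered z.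
Proof.
move=> oy h i i0; have hge := vker_ge h.
have [i_n|] := ltnP i n; last by move=> ?; rewrite ycoord_out.
have := prod_neq0 h (Ordinal i_n) => /=; rewrite /vsite.
have h1 := oy i i0; have h2 := hge i.
case: (eqVneq (ycoord z i.+1)) => [->|_]; first by move=> _; lia.
case: (eqVneq (ycoord z i.+1)) => [->|_]; last by rewrite eqxx.
rewrite eqSS (_ : i == 0%N = false) /=; last by lia.
case: (eqVneq (ycoord z i)) => [->|_]; first by lia.
have [lt|] := ltnP (ycoord y i.+1) (ycoord y i); first by lia.
move=> le; have -> : (ycoord y i - ycoord y i.+1 = 0)%N by lia.
by rewrite /bw expr0 subrr mulr0 mul0r eqxx.
Qed.

Lemma gker_obs gam (A : pred nat) i v p : ~~ A i ->
  act (obs i v p) (gker q gam A) = obs i v (act p (gker q gam A)).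
Proof.
move=> Ai; apply/funext => z; rewrite /act /obs mulr_sumr; apply: eq_bigr => y _.
rewrite -mulrA; have [->|h] := eqVneq (gker q gam A y z) 0; first by rewrite !mulr0.
suff -> : ycoord y i = ycoord z i by [].
case: i Ai => // i Ai.
have [i_n|] := ltnP i n; last by move=> ?; rewrite !ycoord_out.
have := prod_neq0 h (Ordinal i_n) => /=; rewrite /gsite (negbTE Ai).
by case: (eqVneq (ycoord z i.+1)) => // _; rewrite eqxx.
Qed.

(** The jump law of a site reads the preceding site, so a site of [B] must not follow one already
    moved by [A]. Site 1 reads nothing, whence the condition [0 < i]. *)
Lemma gker_comp gam1 gam2 (A B : pred nat) y y' :
  (forall i, A i -> ~~ B i) -> (forall i, (0 < i)%N -> B i.+1 -> ~~ A i) ->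
  \sum_z gker q gam1 A y z * gker q gam2 B z y' =
  gker q (fun i => if A i then gam1 i else gam2 i) (fun i => A i || B i) y y'.
Proof.
move=> AB BA.
(* The only possible intermediate state: sites of [A] are final, all others still initial. *)
pose zs : state := [ffun i : 'I_n => if A i.+1 then y' i else y i].
have zsE i : ycoord zs i = if A i then ycoord y' i else ycoord y i.
  case: i => [|i]; first by case: ifP.
  have [i_n|] := ltnP i n; last by move=> ?; rewrite !ycoord_out //; case: ifP.
  by rewrite !(ycoordS _ (Ordinal i_n)) ffunE /=; case: ifP.
rewrite (bigD1 zs) //= big1 ?addr0.
  rewrite -big_split /=; apply: eq_bigr => i _.
  rewrite /gsite !zsE; case: (boolP (A i.+1)) => Ai /=.
    by rewrite (negbTE (AB _ Ai)) eqxx mulr1.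
  rewrite eqxx mul1r; case: (boolP (B i.+1)) => Bi //.
  case: (posnP i) => [->|i0]; first by rewrite eqxx.
  by rewrite (negbTE (BA _ i0 Bi)).
move=> z /eqP zzs; rewrite -big_split /=.
have [i zi] : exists i, z i != zs i.
  apply: contrapT => nh; apply: zzs; apply/ffunP => i.
  by apply: contrapT => h; apply: nh; exists i; apply/eqP.
rewrite (bigD1 i) //=.
have : ycoord z i.+1 != ycoord zs i.+1 by rewrite !ycoordS.
rewrite zsE /gsite; case: (boolP (A i.+1)) => Ai /= h.
  by rewrite (negbTE (AB _ Ai)) [ycoord y' _ == _]eq_sym (negbTE h) mulr0 mul0r.
by rewrite (negbTE h) !mul0r.
Qed.

Lemma eq_gker gam gam' (A A' : pred nat) y z : (forall i, (0 < i)%N -> A i = A' i) ->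
  (forall i, A i -> gam i = gam' i) -> gker q gam A y z = gker q gam' A' y z.
Proof.
move=> hA hg; apply: eq_bigr => i _; rewrite /gsite -hA //.
by case: ifP => // Ai; rewrite hg.
Qed.

Lemma gker_comm gam1 gam2 (A B : pred nat) y y' :
  (forall i, A i -> ~~ B i) -> (forall i, B i.+1 -> ~~ A i) ->
  (forall i, A i.+1 -> ~~ B i) ->
  \sum_z gker q gam1 A y z * gker q gam2 B z y' =
  \sum_z gker q gam2 B y z * gker q gam1 A z y'.
Proof.
move=> h1 h2 h3; rewrite !gker_comp //; try by move=> *; auto.
- apply: eq_gker => [i _|i]; first by rewrite orbC.
  by case: (boolP (A i)) => Ai; [rewrite (negbTE (h1 _ Ai))|rewrite /= => ->].
- by move=> i Bi; apply/negP => Ai; have := h1 _ Ai; rewrite Bi.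
Qed.

End Vectors.

(** * The intertwining along a time-like path *)

Section TimeLikePath.
Variables (N T : nat -> nat) (M : nat).
Hypothesis N0 : N 0%N = 1%N.
Hypothesis path : forall s, (s < M)%N ->
  (N s.+1 = (N s).+1 /\ T s.+1 = T s) \/ (N s.+1 = N s /\ T s.+1 = (T s).+1).

Lemma N_gt0 s : (s <= M)%N -> (0 < N s)%N.
Proof.
elim: s => [|s IH] sM; first by rewrite N0.
by have := IH (ltnW sM); have := path sM; lia.
Qed.

Lemma T_mono s s' : (s <= s')%N -> (s' <= M)%N -> (T s <= T s')%N.
Proof.
move=> ss; elim: s' ss => [|s' IH] ss sM; first by move: ss; rewrite leqn0 => /eqP ->.
move: ss; rewrite leq_eqVlt => /predU1P[->//|ss].
by apply: leq_trans (IH ss (ltnW sM)) _; have := path sM; lia.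
Qed.

Lemma N_mono s s' : (s <= s')%N -> (s' <= M)%N -> (N s <= N s')%N.
Proof.
move=> ss; elim: s' ss => [|s' IH] ss sM; first by move: ss; rewrite leqn0 => /eqP ->.
move: ss; rewrite leq_eqVlt => /predU1P[->//|ss].
by apply: leq_trans (IH ss (ltnW sM)) _; have := path sM; lia.
Qed.

End TimeLikePath.

Section Intertwining.
Variables (R : realType) (q : R) (u a nu : nat -> R) (n L : nat).
Hypothesis q01 : 0 < q < 1.
Hypothesis u_lt0 : forall i, (0 < i)%N -> u i < 0.
Hypothesis a_gt0 : forall i, (0 < i)%N -> 0 < a i.
Hypothesis nu_ge0 : forall i, (0 < i)%N -> 0 <= nu i.

Local Notation state := (state n L).
Implicit Types (p : state -> R) (y z w : state).

Definition xpar (t i : nat) : R := - (a i * u t).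
Definition gcol (k i : nat) : R := a i * (nu k / a k).
Definition numask (lo hi i : nat) : R := if (lo < i <= hi)%N then nu i else 0.
Definition upto (k i : nat) : bool := (0 < i <= k)%N.
Definition above (k i : nat) : bool := (k < i)%N.

Definition vrow t lo hi : state -> state -> R := vker q (xpar t) (numask lo hi).

(** The lower parts (sites < k) of the geometric moves c_k, k = 2, ..., j + 1, collected after
    everything else. *)
Fixpoint lam (j : nat) p : state -> R :=
  if j is i.+1 then act (lam i p) (gker q (gcol j.+1) (upto j)) else p.

(** The upper parts (sites >= k) of the moves c_k, k = l + 1, ..., l + j, applied in this order;
    they are on their way to time 0. *)
Fixpoint phi (l j : nat) p : state -> R :=
  if j is i.+1 then phi l.+1 i (act p (gker q (gcol l.+1) (above l))) else p.

Lemma xpar_neq t i : (0 < t)%N -> (0 < i)%N -> 1 + xpar t i != 0.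
Proof.
move=> t0 i0; rewrite gt_eqF // addr_gt0 // /xpar -mulrN mulr_gt0 ?a_gt0 //.
by rewrite oppr_gt0 u_lt0.
Qed.

(** With beta = - u_t this reads a_i c_k = (a_i beta)(c_k / beta): the second factor is the
    site-independent [kap] of the exchange relation. *)
Lemma gcolE t k : (0 < t)%N -> gcol k = fun i => xpar t i * (nu k / a k / - u t).
Proof.
move=> t0; apply/funext => i; rewrite /gcol /xpar.
have ut : u t != 0 by rewrite lt_eqF // u_lt0.
by rewrite -mulrN mulrACA divff ?oppr_eq0 // mulr1.
Qed.

Lemma kap_neq t k : (0 < t)%N -> (0 < k)%N -> 1 + nu k / a k / - u t != 0.
Proof.
move=> t0 k0; rewrite gt_eqF // ltr_pwDl //.
have h1 := nu_ge0 k0; have h2 := ltW (a_gt0 k0); have h3 := ltW (u_lt0 t0).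
by rewrite !divr_ge0 ?oppr_ge0.
Qed.

(** The reason why the parameter switched by the exchange in column [k] is exactly the one of the
    vertex model. *)
Lemma gcol_diag k : (0 < k)%N -> gcol k k = nu k.
Proof. by move=> k0; rewrite /gcol mulrC divfK // gt_eqF // a_gt0. Qed.

Lemma ordsupp_lam j p : ordsupp p -> ordsupp (lam j p).
Proof.
elim: j => //= j IH op; apply: ordsupp_act; last exact: IH.
by move=> y z; apply: gker_ordered.
Qed.

Lemma ordsupp_actg gam A p : ordsupp p -> ordsupp (act p (gker q gam A)).
Proof. by apply: ordsupp_act => y z; apply: gker_ordered. Qed.

Lemma ordsupp_actv x v p : ordsupp p -> ordsupp (act p (vker q x v)).
Proof. by apply: ordsupp_act => y z; apply: vker_ordered. Qed.

Lemma lam_obs j i v p : (j < i)%N -> lam j (obs i v p) = obs i v (lam j p).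
Proof.
elim: j => //= j IH ji; rewrite IH ?(ltnW ji) // gker_obs //.
by rewrite /upto; lia.
Qed.

Lemma phi_obs l j i v p : (i <= l)%N -> phi l j (obs i v p) = obs i v (phi l j p).
Proof.
elim: j l p => //= j IH l p il; rewrite gker_obs ?IH //; first by lia.
by rewrite /above; lia.
Qed.

(** The factor c_k covers sites 1, ..., k - 1. A row that crosses it keeps parameter 0 at site 1 and
    loses [nu k] at site k, the site following the interval. *)
Lemma lam_vrow t j p : (0 < t)%N -> (j < n)%N -> ordsupp p ->
  lam j (act p (vrow t 1 n)) = act (lam j p) (vrow t j.+1 n).
Proof.
move=> t0; elim: j => //= j IH jn op; rewrite IH ?(ltnW jn) //.
apply: act_exchange; first exact: ordsupp_lam.
move=> y z oy; rewrite /vrow (@gcolE t) //; apply: vker_gker => //.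
- by move=> i i0; apply: xpar_neq.
- exact: kap_neq.
- by move=> i; rewrite /upto /numask => ?; rewrite ifF //; lia.
- by move=> i; rewrite /upto /numask => ? ?; rewrite ifF //; lia.
- by move=> i; rewrite /upto => ? ?; lia.
- move=> i; rewrite /upto /numask => h1 h2.
  have -> : i = j by lia.
  rewrite ifT; last by lia.
  have /(congr1 (fun f => f j.+2)) /= <- := @gcolE t j.+2 t0.
  by rewrite gcol_diag.
- by move=> i; rewrite /upto /numask => ? ?; rewrite ifF //; lia.
- move=> i; rewrite /upto /numask => ? ?.
  by congr (if _ then _ else _); lia.
Qed.

(** The factor c_m covers all sites from m on, so it has a first site but no end: crossing it only
    switches on column m. *)
Lemma phi_vrow t k l j p : (0 < t)%N -> (0 < k)%N -> (k <= l)%N -> ordsupp p ->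
  phi l j (act p (vrow t k l)) = act (phi l j p) (vrow t k (l + j)).
Proof.
move=> t0 k0; elim: j l p => [|j IH] l p kl op /=; first by rewrite addn0.
rewrite addnS -addSn -IH; [|lia|exact: ordsupp_actg].
congr phi; apply: act_exchange => // y z oy.
rewrite /vrow (@gcolE t) //; apply: vker_gker => //.
- by move=> i i0; apply: xpar_neq.
- exact: kap_neq.
- by move=> i; rewrite /above /numask => ?; rewrite ifF //; lia.
- by rewrite /above; lia.
- by move=> i; rewrite /above /numask => ? ?; rewrite ifF //; lia.
- move=> i; rewrite /above /numask => h1 h2.
  have -> : l = i.+1 by lia.
  rewrite ifT; last by lia.
  have /(congr1 (fun f => f i.+2)) /= <- := @gcolE t i.+2 t0.
  by rewrite gcol_diag.
- by move=> i; rewrite /above => ? ?; lia.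
- by move=> i; rewrite /above => ? ?; lia.
- move=> i; rewrite /above /numask => ? ?.
  by congr (if _ then _ else _); lia.
Qed.

Lemma phi_upto gam k l j p : (k < l)%N ->
  phi l j (act p (gker q gam (upto k))) = act (phi l j p) (gker q gam (upto k)).
Proof.
elim: j l p => //= j IH l p kl; rewrite -IH; last by lia.
congr phi; apply/funext => z; rewrite !act_act; apply: eq_bigr => y _; congr (_ * _).
apply: gker_comm => i; rewrite /upto /above; lia.
Qed.

(** The upper part goes first, since its first site has to read the position of site [k] before the
    move. *)
Lemma gker_split gam k p :
  act p (gker q gam (above 0)) =
  act (act p (gker q gam (above k))) (gker q gam (upto k)).
Proof.
apply/funext => z; rewrite act_act; apply: eq_bigr => y _; congr (_ * _).
rewrite gker_comp; last 2 first.
- by move=> i; rewrite /above /upto; lia.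
- by move=> i i0; rewrite /above /upto; lia.
apply: eq_gker => [i i0|i _]; first by rewrite /above /upto; lia.
by case: ifP.
Qed.

Definition origin : state -> R := fun y => (y == [ffun => ord0])%:R.

Lemma ycoord0 i : ycoord ([ffun => ord0] : state) i = 0%N.
Proof.
case: i => // i; have [i_n|] := ltnP i n; last by move=> ?; rewrite ycoord_out.
by rewrite (ycoordS _ (Ordinal i_n)) ffunE.
Qed.

Lemma ordsupp_origin : ordsupp origin.
Proof.
move=> y; rewrite /origin; case: (eqVneq y [ffun => ord0]) => [->|]; last by rewrite eqxx.
by move=> _ i _; rewrite !ycoord0.
Qed.

Lemma act_origin K : act origin K = K [ffun => ord0].
Proof.
apply/funext => z; rewrite /act (bigD1 [ffun => ord0]) //= big1 ?addr0.
  by rewrite /origin eqxx mul1r.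
by move=> y /negbTE y0; rewrite /origin y0 mul0r.
Qed.

(** All gaps of the step configuration vanish and a zero gap forces the jump 0; site 1, with its
    infinite gap, is excluded by [0 < k]. *)
Lemma gker_origin gam k : (0 < k)%N ->
  act origin (gker q gam (above k)) = origin.
Proof.
move=> k0; rewrite act_origin; apply/funext => z; rewrite /origin.
have [->|z0] := eqVneq z [ffun => ord0].
  rewrite /gker big1 // => i _; rewrite !ycoord0 /gsite eqxx leqnn.
  case: ifP => //; rewrite /above => ki; rewrite ifF; last by lia.
  by rewrite pfin0 // qpoch0.
have [i zi] : exists i, z i != ord0.
  apply: contrapT => nh; move/negP: z0; apply; apply/eqP/ffunP => i.
  by apply: contrapT => h; apply: nh; exists i; rewrite ffunE in h; apply/eqP.
rewrite /gker (bigD1 i) //= /gsite !ycoord0 ycoordS !subn0 leq0n.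
have zi0 : (0 < z i)%N by rewrite lt0n.
case: ifP; rewrite /above => ki.
  by rewrite ifF ?pfin_gt ?mul0r //; lia.
by rewrite (gtn_eqF zi0) mul0r.
Qed.

Lemma phi_origin l j : (0 < l)%N -> phi l j origin = origin.
Proof. by elim: j l => //= j IH l l0; rewrite gker_origin // IH. Qed.

(** * Measures restricted by the observations along the path *)

Section Path.
Variables (N T : nat -> nat) (M : nat) (kk : nat -> int).
Hypotheses (N0 : N 0%N = 1%N) (T0 : T 0%N = 0%N).
Hypothesis path : forall s, (s < M)%N ->
  (N s.+1 = (N s).+1 /\ T s.+1 = T s) \/ (N s.+1 = N s /\ T s.+1 = (T s).+1).

Definition qstep s : state -> state -> R :=
  if T s.+1 == (T s).+1 then vker q (xpar (T s.+1)) (fun=> 0)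
  else gker q (gcol (N s.+1)) (above 0).

Fixpoint qmeas s : state -> R :=
  if s is r.+1 then obs (N s) (kk s) (act (qmeas r) (qstep r))
  else obs (N 0%N) (kk 0%N) origin.

Fixpoint vmeas s : state -> R :=
  if s is r.+1 then
    obs (N s) (kk s) (if T s == (T r).+1 then act (vmeas r) (vrow (T s) 1 n) else vmeas r)
  else obs (N 0%N) (kk 0%N) origin.

Lemma ordsupp_qmeas s : ordsupp (qmeas s).
Proof.
elim: s => [|s IH] /=; apply: ordsupp_obs; first exact: ordsupp_origin.
by rewrite /qstep; case: ifP => _; [apply: ordsupp_actv|apply: ordsupp_actg].
Qed.

Lemma ordsupp_vmeas s : ordsupp (vmeas s).
Proof.
elim: s => [|s IH] /=; apply: ordsupp_obs; first exact: ordsupp_origin.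
by case: ifP => // _; apply: ordsupp_actv.
Qed.

(** Invariant along the path: on the left the upper parts of the geometric moves still to come, on
    the right the lower parts of those already made. At time 0 the first family acts trivially on
    the origin and the second is empty. *)
Lemma qmeas_vmeas s : (s <= M)%N -> (N s <= n)%N ->
  phi (N s) (n - N s) (qmeas s) = lam (N s).-1 (vmeas s).
Proof.
elim: s => [|s IH] sM Nn.
  by rewrite N0 /= phi_obs N0 // phi_origin.
have Ns0 := N_gt0 N0 path (ltnW sM).
case: (path sM) => -[NE TE].
  have TF : (T s.+1 == (T s).+1) = false by lia.
  (* Geometric step: the upper part of the new move is the first factor of [phi] in the induction
     hypothesis, its lower part becomes the last factor of [lam]. *)
  rewrite /= /qstep TF NE (gker_split _ (N s)) phi_obs // phi_upto //.
  have IHs : phi (N s) (n - N s).-1.+1 (qmeas s) = lam (N s).-1 (vmeas s).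
    by rewrite -IH; [congr phi; lia|lia|lia].
  rewrite (_ : n - (N s).+1 = (n - N s).-1)%N; last by lia.
  move: IHs => /= ->; rewrite lam_obs //; congr obs.
  by case: (N s) Ns0.
rewrite /= /qstep TE eqxx NE.
(* Bernoulli step: a row with an empty mask. [phi_vrow] switches on the columns beyond [N s], and
   [lam_vrow], read backwards, the columns 2, ..., [N s]. *)
rewrite (_ : vker q _ _ = vrow (T s).+1 (N s) (N s)); last first.
  apply/funext => y; apply/funext => z; rewrite /vrow; congr vker.
  by apply/funext => i; rewrite /numask ifF //; lia.
rewrite phi_obs // phi_vrow //; last exact: ordsupp_qmeas.
rewrite IH //; [|lia|lia].
rewrite lam_obs ?lam_vrow //; [|lia|exact: ordsupp_vmeas|lia].
by rewrite prednK // subnKC // -NE.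
Qed.

End Path.
End Intertwining.

(** * Normalization of the jump distributions *)

Section Normalization.
Local Open Scope classical_set_scope.
Local Open Scope ring_scope.
Variables (R : realType) (q : R).
Hypothesis q01 : 0 < q < 1.

Lemma qpochSl (z : R) k : qpoch z q k.+1 = (1 - z) * qpoch (q * z) q k.
Proof.
rewrite /qpoch big_ord_recl expr0 mulr1; congr (_ * _); apply: eq_bigr => i _.
by rewrite lift0 exprS mulrA [q * z]mulrC.
Qed.

(** A q-Pascal rule. For j >= m the truncated exponent [m - j.+1] is harmless because its factor
    [pfin q m g j.+1] is 0. *)
Lemma pfin_rec m (g : R) j :
  pfin q m.+1 g j.+1 =
  pfin q m g j.+1 * (1 - g * q ^+ (m - j.+1)) + g * q ^+ (m - j) * pfin q m g j.
Proof.
have [jm|] := ltnP j m; last rewrite leq_eqVlt => /predU1P[->|mj].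
- have [e ->] : exists e, m = (j + e).+1 by exists (m - j.+1)%N; lia.
  rewrite pfin_pfu3 // pfin_pfu1 // pfin_pfu2 //.
  have -> : ((j + e).+1 - j.+1 = e)%N by lia.
  have -> : ((j + e).+1 - j = e.+1)%N by lia.
  by rewrite !exprS; ring.
- by rewrite subnn !pfinn // pfin_gt // expr0 mulr1 mul0r add0r exprS.
- by rewrite !pfin_gt // 1?ltnW // mul0r mulr0 addr0.
Qed.

(** When m grows by one, the mass at j is divided between j and j + 1 in the proportions 1 - g
    q^(m-j) and g q^(m-j). *)
Lemma pfin_sum m (g : R) : \sum_(j < m.+1) pfin q m g j = 1.
Proof.
elim: m => [|m IH]; first by rewrite big_ord1 pfin0 // qpoch0.
pose A j := pfin q m g j * (1 - g * q ^+ (m - j)).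
have -> : \sum_(j < m.+2) pfin q m.+1 g j =
    \sum_(j < m.+2) A j + \sum_(j < m.+1) g * q ^+ (m - j) * pfin q m g j.
  rewrite big_ord_recl [\sum_(j < m.+2) A j]big_ord_recl -addrA -big_split /=.
  congr (_ + _); first by rewrite /A !pfin0 // qpochS subn0.
  by apply: eq_bigr => i _; rewrite pfin_rec.
rewrite big_ord_recr /= {2}/A pfin_gt // mul0r addr0 -big_split /= -[RHS]IH.
by apply: eq_bigr => i _; rewrite /A; ring.
Qed.

Lemma pfin_ge0 m (g : R) j : 0 <= g < 1 -> 0 <= pfin q m g j.
Proof.
move=> /andP[g0 g1]; rewrite /pfin; case: ifP => // _.
have q1 : q < 1 by case/andP: q01.
by rewrite !mulr_ge0 ?exprn_ge0 ?invr_ge0 ?mulr_ge0 // ltW // qpoch_gt0.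
Qed.

Definition esum_part (g : R) l := \sum_(j < l.+1) g ^+ j / qpoch q q j.

Lemma esum_partS (g : R) l :
  esum_part g l.+1 = esum_part g l + g ^+ l.+1 / qpoch q q l.+1.
Proof. by rewrite /esum_part big_ord_recr. Qed.

(** Truncated form of the functional equation (1 - g) E(g) = E(q g) of Euler's series. *)
Lemma esum_partE (g : R) l :
  (1 - g) * esum_part g l = esum_part (q * g) l - g ^+ l.+1 / qpoch q q l.
Proof.
elim: l => [|l IH].
  by rewrite /esum_part !big_ord1 !expr0 !qpoch0 !divr1 expr1; ring.
rewrite !esum_partS mulrDr IH qpochS.
have h1 := qpochqq_neq0 q01 l; have h2 := oneBqX_neq0 q01 l.
rewrite exprMn; move: h2; rewrite !exprS => h2; field.
by rewrite h1 h2.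
Qed.

Lemma qpochqq_gt0 k : 0 < qpoch q q k.
Proof. by case/andP: q01 => _ h; rewrite qpoch_gt0. Qed.

(** Iterate the functional equation and drop the nonnegative remainders. *)
Lemma esum_part_ub (g : R) l m : 0 <= g < 1 ->
  qpoch g q m * esum_part g l <= esum_part (g * q ^+ m) l.
Proof.
elim: m g => [|m IH] g /andP[g0 g1]; first by rewrite qpoch0 mul1r expr0 mulr1.
have [q0 q1] := andP q01.
have qg : 0 <= q * g < 1.
  apply/andP; split; first by rewrite mulr_ge0 // ltW.
  by rewrite (le_lt_trans _ g1) // ler_piMl // ltW.
rewrite qpochSl mulrAC esum_partE mulrC.
have -> : g * q ^+ m.+1 = q * g * q ^+ m by rewrite exprS; ring.
apply: le_trans (IH _ qg); apply: ler_wpM2l.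
  by rewrite ltW // qpoch_gt0 //; case/andP: qg.
by rewrite gerBl divr_ge0 ?exprn_ge0 // ltW // qpochqq_gt0.
Qed.

Lemma esum_part_lb (g : R) l m : 0 <= g < 1 ->
  1 - g ^+ l.+1 / qpoch q q l.+1 <= qpoch g q m * esum_part g l.
Proof.
have [q0 q1] := andP q01.
elim: m g => [|m IH] g /andP[g0 g1].
  rewrite qpoch0 mul1r (@le_trans _ _ 1) //.
    by rewrite gerBl divr_ge0 ?exprn_ge0 // ltW // qpochqq_gt0.
  rewrite /esum_part big_ord_recl expr0 qpoch0 divr1 lerDl sumr_ge0 // => i _.
  by rewrite divr_ge0 ?exprn_ge0 // ltW // qpochqq_gt0.
have qg : 0 <= q * g < 1.
  apply/andP; split; first by rewrite mulr_ge0 // ltW.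
  by rewrite (le_lt_trans _ g1) // ler_piMl // ltW.
rewrite [qpoch g q m.+1]qpochSl mulrAC esum_partE mulrBl [esum_part _ _ * _]mulrC.
apply: le_trans (lerB (IH _ qg) (_ : g ^+ l.+1 / qpoch q q l * _ <= g ^+ l.+1 / qpoch q q l)); last first.
  apply: ler_piMr; first by rewrite divr_ge0 ?exprn_ge0 // ltW // qpochqq_gt0.
  rewrite /qpoch; apply: prodr_ile1 => i _.
  have h1 := expq_gt0 q01 i; have h2 := expq_le1 q01 i.
  have /andP[h3 h4] := qg.
  have : 0 <= q * g * q ^+ i <= 1.
    apply/andP; split; first by rewrite mulr_ge0 // ltW.
    by apply: mulr_ile1 => //; apply: ltW.
  by lra.
(* The new remainder and the one of the induction hypothesis add up exactly, since q^(l+1) + (1 -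
   q^(l+1)) = 1. *)
rewrite qpochS exprMn.
have h1 := qpochqq_neq0 q01 l; have h2 := oneBqX_neq0 q01 l.
rewrite le_eqVlt; apply/orP; left; apply/eqP.
move: h2; rewrite !exprS => h2; field.
by rewrite h1 h2.
Qed.

Lemma qpoch_cvg (g : R) : 0 <= g < 1 -> (fun k => qpoch g q k) @ \oo --> qpoch_inf g q.
Proof.
move=> /andP[g0 g1]; apply: nonincreasing_is_cvgn; last first.
  by exists 0 => _ [k _ <-]; rewrite ltW // qpoch_gt0.
apply/nonincreasing_seqP => k; rewrite qpochS; apply: ler_piMr.
  by rewrite ltW // qpoch_gt0.
by rewrite gerBl mulr_ge0 // ltW // expq_gt0.
Qed.

Lemma qpoch_inf_ge0 (g : R) : 0 <= g < 1 -> 0 <= qpoch_inf g q.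
Proof.
move=> g01; apply: limr_ge; first by apply: cvgP (qpoch_cvg g01).
by near=> k; rewrite ltW // qpoch_gt0 //; case/andP: g01.
Unshelve. all: by end_near. Qed.

Lemma pinf_ge0 (g : R) j : 0 <= g < 1 -> 0 <= pinf q g j.
Proof.
move=> g01; have /andP[g0 _] := g01.
rewrite /pinf divr_ge0 ?mulr_ge0 ?exprn_ge0 ?qpoch_inf_ge0 //.
by rewrite ltW // qpochqq_gt0.
Qed.

Lemma pinf_part (g : R) l :
  \sum_(j < l.+1) pinf q g j = qpoch_inf g q * esum_part g l.
Proof.
rewrite /esum_part mulr_sumr; apply: eq_bigr => j _.
by rewrite /pinf mulrAC mulrC.
Qed.

Lemma pinf_part_le1 (g : R) l : 0 <= g < 1 -> \sum_(j < l.+1) pinf q g j <= 1.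
Proof.
move=> g01; have /andP[g0 g1] := g01; rewrite pinf_part.
have [q0 q1] := andP q01.
have c1 : (fun m => qpoch g q m * esum_part g l) @ \oo --> qpoch_inf g q * esum_part g l.
  by apply: cvgMl; apply: qpoch_cvg.
(* An upper bound for the partial sum at g q^m: each term except the first carries a factor at most
   q^m. *)
have c2 : (fun m => 1 + q ^+ m * (esum_part g l - 1)) @ \oo --> (1 + 0 * (esum_part g l - 1) : R).
  apply: cvgD; first exact: cvg_cst.
  apply: cvgMl; apply: cvg_expr; by rewrite ger0_norm ?ltW.
rewrite mul0r addr0 in c2.
apply: (ler_cvg_to c1 c2); near=> m.
apply: le_trans (esum_part_ub l m g01) _.
rewrite /esum_part !big_ord_recl !expr0 qpoch0 divr1 addrAC subrr add0r lerD2l mulr_sumr.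
apply: ler_sum => i _; rewrite mulrA; apply: ler_wpM2r.
  by rewrite invr_ge0 ltW // qpochqq_gt0.
rewrite exprMn mulrC; apply: ler_wpM2r; first exact: exprn_ge0.
rewrite lift0 exprS -[leRHS]mulr1; apply: ler_wpM2l; first by rewrite exprn_ge0 // ltW.
by rewrite -exprM expq_le1.
Unshelve. all: by end_near. Qed.

Lemma pinf_part_lb (g : R) l : 0 <= g < 1 ->
  1 - g ^+ l.+1 / qpoch q q l.+1 <= \sum_(j < l.+1) pinf q g j.
Proof.
move=> g01; rewrite pinf_part.
have c1 : (fun m => qpoch g q m * esum_part g l) @ \oo --> qpoch_inf g q * esum_part g l.
  by apply: cvgMl; apply: qpoch_cvg.
apply: (ler_cvg_to (cvg_cst _) c1); near=> m.
exact: esum_part_lb.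
Unshelve. all: by end_near. Qed.

Lemma expr_qpoch_cvg0 (g : R) : 0 <= g < 1 ->
  (fun l => g ^+ l / qpoch q q l) @ \oo --> (0 : R).
Proof.
move=> /andP[g0 g1]; have [q0 q1] := andP q01.
(* Once q^l <= (1 - g) / 2, the ratio g / (1 - q^l) of successive terms is at most this number,
   which is below 1. *)
pose rho := 2 * g / (1 + g).
have rho01 : 0 <= rho < 1.
  by rewrite /rho divr_ge0 ?mulr_ge0 ?addr_ge0 //= ltr_pdivrMr ?mul1r; lra.
have [l0 hl0] : exists l0, forall l, (l0 <= l)%N -> q ^+ l <= (1 - g) / 2.
  have : (fun l => q ^+ l) @ \oo --> (0 : R) by apply: cvg_expr; rewrite ger0_norm ?ltW.
  move=> /cvgrPdist_le /(_ ((1 - g) / 2)) []; first by rewrite divr_gt0 // subr_gt0.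
  move=> l0 _ h; exists l0 => l ll0; have := h l ll0.
  by rewrite /= sub0r normrN ger0_norm // exprn_ge0 // ltW.
pose C := g ^+ l0 / qpoch q q l0.
have C0 : 0 <= C by rewrite divr_ge0 ?exprn_ge0 // ltW // qpochqq_gt0.
have step k : g ^+ (k + l0) / qpoch q q (k + l0) <= C * rho ^+ k.
  elim: k => [|k IH]; first by rewrite add0n expr0 mulr1.
  rewrite addSn exprS qpochS exprSr.
  have h := hl0 (k + l0).+1 (leq_trans (leq_addl k l0) (leqnSn _)).
  have h2 := qpochqq_gt0 (k + l0).
  have e : 0 < 1 - q * q ^+ (k + l0) by rewrite -exprS; move: g1 h; lra.
  have -> : g * g ^+ (k + l0) / (qpoch q q (k + l0) * (1 - q * q ^+ (k + l0))) =
    g ^+ (k + l0) / qpoch q q (k + l0) * (g / (1 - q * q ^+ (k + l0))).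
    by field; rewrite !gt_eqF.
  rewrite [leRHS]mulrA; apply: ler_pM => //.
  - by rewrite divr_ge0 ?exprn_ge0 // ltW.
  - by rewrite divr_ge0 // ltW.
  rewrite /rho [2 * g]mulrC -mulrA ler_wpM2l // -[2 / _]invf_div lef_pV2 ?posrE //.
    by rewrite -exprS; move: h; lra.
  by move: g0; lra.
rewrite -(cvg_shiftn l0) /=.
have cC : (fun k => C * rho ^+ k) @ \oo --> (0 : R).
  rewrite -[0](mulr0 C); apply: cvgMr; apply: cvg_expr.
  by case/andP: rho01 => r0 r1; rewrite ger0_norm.
apply: (squeeze_cvgr _ (cvg_cst 0) cC); near=> k; rewrite step andbT.
by rewrite divr_ge0 ?exprn_ge0 // ltW // qpochqq_gt0.
Unshelve. all: by end_near. Qed.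

Lemma pinf_part_cvg (g : R) : 0 <= g < 1 ->
  (fun l => \sum_(j < l.+1) pinf q g j) @ \oo --> (1 : R).
Proof.
move=> g01.
have c : (fun l => 1 - g ^+ l.+1 / qpoch q q l.+1) @ \oo --> (1 : R).
  rewrite -[X in _ --> X]subr0; apply: cvgB; first exact: cvg_cst.
  by have := expr_qpoch_cvg0 g01; rewrite -cvg_shiftS.
apply: (squeeze_cvgr _ c (cvg_cst (1 : R))); near=> l.
by rewrite pinf_part_lb // pinf_part_le1.
Unshelve. all: by end_near. Qed.

End Normalization.

(** * Total mass of the geometric moves *)

Section Mass.
Variables (R : realType) (q : R) (n L : nat).
Hypothesis q01 : 0 < q < 1.
Hypothesis n_gt0 : (0 < n)%N.

Local Notation state := (state n L).
Implicit Types (p : state -> R) (y z w : state).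

Lemma sum_shift (F : nat -> R) (y : nat) : (y <= L)%N ->
  \sum_(t < L.+1) (if (y <= t)%N then F (t - y)%N else 0) = \sum_(j < (L - y).+1) F j.
Proof.
move=> yL; rewrite -(big_mkord xpredT (fun t => if (y <= t)%N then F (t - y)%N else 0)).
rewrite (@big_cat_nat _ _ _ y) //=; last by lia.
rewrite big_nat big1 ?add0r; last by move=> i /andP[_ iy]; rewrite leqNgt iy.
rewrite -{1}[y]add0n big_addn (_ : L.+1 - y = (L - y).+1)%N; last by lia.
by rewrite big_mkord; apply: eq_bigr => i _; rewrite leq_addl addnK.
Qed.

Lemma sum_trunc (F : nat -> R) m l : (m <= l)%N -> (forall j, (m < j)%N -> F j = 0) ->
  \sum_(j < l.+1) F j = \sum_(j < m.+1) F j.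
Proof.
move=> ml F0; rewrite -!(big_mkord xpredT F) (@big_cat_nat _ _ _ m.+1) //=.
by rewrite [X in _ + X]big_nat [X in _ + X]big1 ?addr0 // => i /andP[mi _]; apply: F0.
Qed.

(** Beyond site 1 a jump is at most the gap, so the bound [L] costs no mass; only site 1 can leave
    the truncated range. *)
Lemma gsite_sum gam A i yp (y : nat) : (1 < i)%N -> (yp <= L)%N -> (y <= L)%N ->
  \sum_(t < L.+1) gsite q gam A i yp y t = 1.
Proof.
move=> i1 ypL yL; rewrite /gsite; case: (boolP (A i)) => Ai; last first.
  rewrite (@sum_one _ (fun t => (t == y)%:R) y) ?eqxx //.
  by move=> t /negbTE ->.
rewrite (gtn_eqF i1) (sum_shift (pfin q (yp - y) (gam i))) //.
rewrite (@sum_trunc _ (yp - y)) ?pfin_sum //; first by lia.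
by move=> j; apply: pfin_gt.
Qed.

Lemma gsite_ge0 gam A i yp (y y' : nat) : (forall i, (0 < i)%N -> 0 <= gam i < 1) ->
  (0 < i)%N -> 0 <= gsite q gam A i yp y y'.
Proof.
move=> hg i0; rewrite /gsite; case: ifP => // _; case: ifP => // _.
by case: ifP => _; [apply: pinf_ge0|apply: pfin_ge0] => //; apply: hg.
Qed.

Lemma gker_ge0 gam A y z : (forall i, (0 < i)%N -> 0 <= gam i < 1) ->
  0 <= gker q gam A y z.
Proof. by move=> hg; apply: prodr_ge0 => i _; apply: gsite_ge0. Qed.

Lemma bw_ge0 (x nu : R) g b o : 0 <= x -> 0 <= nu <= 1 -> 0 <= bw q x nu g b o.
Proof.
move=> x0 /andP[nu0 nu1].
have h1 := ltW (expq_gt0 q01 g); have h2 := expq_le1 q01 g.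
have h3 : 0 <= nu * q ^+ g by apply: mulr_ge0.
have h4 : nu * q ^+ g <= 1 by apply: mulr_ile1.
have h5 : 0 <= x * q ^+ g by apply: mulr_ge0.
have h6 : 0 <= 1 + x by lra.
case: b; case: o; rewrite /bw; apply: divr_ge0 => //; try lra.
by apply: mulr_ge0 => //; lra.
Qed.

Lemma vker_ge0 x nu y z : (forall i, (0 < i)%N -> 0 <= x i) ->
  (forall i, (0 < i)%N -> 0 <= nu i <= 1) -> 0 <= vker q x nu y z.
Proof.
move=> x0 hnu; apply: prodr_ge0 => i _; rewrite /vsite.
by do 2 (case: ifP => _; first by apply: bw_ge0; [apply: x0|apply: hnu]).
Qed.

Lemma act_ge0 p (K : state -> state -> R) : (forall y, 0 <= p y) ->
  (forall y z, 0 <= K y z) -> forall z, 0 <= act p K z.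
Proof. by move=> p0 K0 z; apply: sumr_ge0 => y _; apply: mulr_ge0. Qed.

Definition massle (B : nat) p : R := \sum_y p y * (ycoord y 1 <= B)%N%:R.

Lemma massleL p : massle L p = \sum_y p y.
Proof. by apply: eq_bigr => y _; rewrite ycoord_le mulr1. Qed.

Lemma gker_mass gam A B y :
  \sum_z gker q gam A y z * (ycoord z 1 <= B)%N%:R =
  \sum_(t < L.+1) gsite q gam A 1 0 (ycoord y 1) t * (t <= B)%N%:R.
Proof.
pose F (i : 'I_n) (t : 'I_L.+1) : R :=
  gsite q gam A i.+1 (ycoord y i) (ycoord y i.+1) t *
  (if i == 0%N :> nat then (t <= B)%N%:R else 1).
pose i0 := Ordinal n_gt0.
transitivity (\sum_(z : state) \prod_i F i (z i)).
  apply: eq_bigr => z _; rewrite /F big_split /=; congr (_ * _).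
    by apply: eq_bigr => i _; rewrite (ycoordS z i).
  rewrite (bigD1 i0) //= big1 ?mulr1 ?(ycoordS z i0) // => i ii0.
  by rewrite ifF //; apply: contraNF ii0 => /eqP h; apply/eqP/val_inj.
rewrite -bigA_distr_bigA (bigD1 i0) //= [X in _ * X]big1 ?mulr1 // => i ii0.
have i1 : (0 < i)%N.
  by rewrite lt0n; apply: contraNneq ii0 => h; apply/eqP/val_inj.
rewrite -[RHS](@gsite_sum gam A i.+1 (ycoord y i) (ycoord y i.+1)) ?ycoord_le //.
by apply: eq_bigr => t _; rewrite /F ifF ?mulr1 //; lia.
Qed.

Lemma massle_act gam A B p :
  massle B (act p (gker q gam A)) =
  \sum_y p y * \sum_(t < L.+1) gsite q gam A 1 0 (ycoord y 1) t * (t <= B)%N%:R.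
Proof.
rewrite /massle /act; under eq_bigr => z _ do rewrite mulr_suml.
rewrite exchange_big /=; apply: eq_bigr => y _; rewrite -gker_mass mulr_sumr.
by apply: eq_bigr => z _; rewrite mulrA.
Qed.

Lemma mass_act_le gam (A : pred nat) p : (forall y, 0 <= p y) -> A 1%N -> 0 <= gam 1%N < 1 ->
  \sum_y act p (gker q gam A) y <= \sum_y p y.
Proof.
move=> p0 A1 hg; rewrite -massleL massle_act; apply: ler_sum => y _.
rewrite -[leRHS]mulr1; apply: ler_wpM2l => //.
under eq_bigr => t _ do rewrite leq_ord mulr1 /gsite A1 eqxx.
by rewrite (sum_shift (pinf q (gam 1%N))) ?ycoord_le // pinf_part_le1.
Qed.

(** Only the jumps of particle 1 up to [l] are kept; starting from at most [B] they stay below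
    [B + l], hence inside the truncation. *)
Lemma massle_act_ge gam (A : pred nat) p B l : (forall y, 0 <= p y) -> A 1%N ->
  0 <= gam 1%N < 1 -> (B + l <= L)%N ->
  (\sum_(j < l.+1) pinf q (gam 1%N) j) * massle B p <= massle (B + l) (act p (gker q gam A)).
Proof.
move=> p0 A1 hg BL; rewrite massle_act mulr_sumr; apply: ler_sum => y _.
rewrite mulrCA; apply: ler_wpM2l => //.
have g0 j : 0 <= pinf q (gam 1%N) j by apply: pinf_ge0.
have [yB|_] := leqP (ycoord y 1) B; last first.
  rewrite mulr0; apply: sumr_ge0 => t _; apply: mulr_ge0 => //.
  by rewrite /gsite A1; case: ifP.
have yL := ycoord_le y 1.
have -> : \sum_(j < l.+1) pinf q (gam 1%N) j =
    \sum_(j < l.+1) pinf q (gam 1%N) j * (j <= l)%N%:R.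
  by apply: eq_bigr => j _; rewrite leq_ord mulr1.
rewrite mulr1 -(@sum_trunc (fun j => pinf q (gam 1%N) j * (j <= l)%N%:R) l (L - ycoord y 1)).
- rewrite -(sum_shift (fun j => pinf q (gam 1%N) j * (j <= l)%N%:R)) //.
  apply: ler_sum => t _; rewrite /gsite A1 /=; case: ifP => _; last by rewrite mul0r.
  apply: ler_wpM2l => //; rewrite ler_nat.
  case: (leqP (t - ycoord y 1) l) => //= h.
  by have -> : (t <= B + l)%N by lia.
- by lia.
- by move=> j lj; rewrite leqNgt lj mulr0.
Qed.

End Mass.

(** * Sums over trajectories *)

Section PathSum.
Variables (R : realType) (n L : nat) (X : finType) (inc : X -> nat -> nat).

Local Notation state := (state n L).

Definition rowf s (rho : {ffun 'I_s -> X}) (r i : nat) : nat :=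
  if insub r is Some r' then inc (rho r') i else 0%N.

Definition posn s (rho : {ffun 'I_s -> X}) (r i : nat) : nat :=
  (\sum_(r' < r) rowf rho r' i)%N.

Lemma rowfS s (rho : {ffun 'I_s -> X}) (r : 'I_s) : rowf rho r = inc (rho r).
Proof. by apply/funext => i; rewrite /rowf valK. Qed.

Lemma rowf_frcons s (rho : {ffun 'I_s -> X}) x r : (r < s)%N ->
  rowf (frcons rho x) r = rowf rho r.
Proof.
move=> rs; apply/funext => i; rewrite /rowf.
have rs1 : (r < s.+1)%N by lia.
rewrite (insubT (fun k => k < s)%N rs) (insubT (fun k => k < s.+1)%N rs1) /= ffunE.
case: unliftP => [j jE|jE].
  suff -> : j = Ordinal rs by [].
  by apply/val_inj; rewrite /= -(lift_max j) -jE.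
by move/(congr1 val): jE => /=; lia.
Qed.

Lemma rowf_frcons_last s (rho : {ffun 'I_s -> X}) x : rowf (frcons rho x) s = inc x.
Proof. by rewrite (rowfS (frcons rho x) ord_max) ffunE unlift_none. Qed.

Lemma posn_frcons s (rho : {ffun 'I_s -> X}) x r : (r <= s)%N ->
  posn (frcons rho x) r = posn rho r.
Proof.
move=> rs; apply/funext => i; apply: eq_bigr => r' _.
by rewrite rowf_frcons //; apply: leq_trans rs.
Qed.

Lemma posn_frcons_last s (rho : {ffun 'I_s -> X}) x i :
  posn (frcons rho x) s.+1 i = (posn rho s i + inc x i)%N.
Proof. by rewrite {1}/posn big_ord_recr /= rowf_frcons_last -/(posn _ _ _) posn_frcons. Qed.

Definition at_state (f : nat -> nat) (y : state) : bool :=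
  [forall i : 'I_n, f i.+1 == y i].

Hypothesis inc_out : forall x i, ~~ (0 < i <= n)%N -> inc x i = 0%N.
Hypothesis inc_inj : forall x x', inc x = inc x' -> x = x'.

Lemma posn_out s (rho : {ffun 'I_s -> X}) r i : ~~ (0 < i <= n)%N -> posn rho r i = 0%N.
Proof.
move=> h; rewrite /posn big1 // => r' _; rewrite /rowf.
by case: insub => // r''; rewrite inc_out.
Qed.

Lemma at_stateP (f : nat -> nat) y : (forall i, ~~ (0 < i <= n)%N -> f i = 0%N) ->
  reflect (f = ycoord y) (at_state f y).
Proof.
move=> f0; apply: (iffP forallP) => [h|-> i]; last by rewrite ycoordS.
apply/funext => -[|i]; first by rewrite f0.
have [i_n|i_n] := ltnP i n; last by rewrite f0 ?ycoord_out //; lia.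
by rewrite (ycoordS _ (Ordinal i_n)); apply/eqP; apply: (h (Ordinal i_n)).
Qed.

Lemma at_state_inj f y z : at_state f y -> at_state f z -> y = z.
Proof.
move=> /forallP hy /forallP hz; apply/ffunP => i; apply/val_inj.
by rewrite /= -(eqP (hy i)) -(eqP (hz i)).
Qed.

Variables (w : nat -> (nat -> nat) -> (nat -> nat) -> R).
Variables (o : nat -> (nat -> nat) -> bool).
Variables (K : nat -> state -> state -> R) (mu : nat -> state -> R).
Hypothesis mu0 : forall y, mu 0 y = (o 0 (ycoord y))%:R * origin R y.
Hypothesis muS : forall s y, mu s.+1 y = (o s.+1 (ycoord y))%:R * act (mu s) (K s) y.
Hypothesis wK : forall s (y z : state) x, mu s y != 0 ->
  (forall i, ycoord y i + inc x i = ycoord z i)%N ->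
  w s (ycoord y) (inc x) = K s y z.
Hypothesis Kx : forall s y z, mu s y != 0 -> K s y z != 0 ->
  exists x, forall i, (ycoord y i + inc x i = ycoord z i)%N.

Definition pathw s (rho : {ffun 'I_s -> X}) : R :=
  (\prod_(r < s) w r (posn rho r) (rowf rho r)) *
  (\prod_(r < s.+1) (o r (posn rho r))%:R).

(** Sums over trajectories as iterated kernels, for both models: a step is a vector of jumps or a
    row of bits. Trajectory weights and kernels need to agree only on states charged by [mu],
    because the raw weights are meaningful only there. *)
Lemma path_sum s y :
  \sum_(rho : {ffun 'I_s -> X}) pathw rho * (at_state (posn rho s) y)%:R = mu s y.
Proof.
elim: s y => [|s IH] y.
  rewrite mu0 (big_pred1 (ffun0 (card_ord 0))); last first.
    by move=> z; symmetry; apply/eqP/ffunP => -[].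
  rewrite /pathw big_ord0 big_ord1 mul1r.
  have p0 : posn (ffun0 (rT := fun=> X) (card_ord 0)) 0 = fun=> 0%N.
    by apply/funext => i; rewrite /posn big_ord0.
  rewrite p0 /origin; have [->|y0] := eqVneq y [ffun => ord0].
    rewrite (_ : ycoord _ = fun=> 0%N); last by apply/funext => i; rewrite ycoord0.
    by rewrite (_ : at_state _ _) //; apply/forallP => i; rewrite ffunE.
  rewrite (_ : at_state _ _ = false) ?mulr0 //; apply/forallP => h.
  move/negP: y0; apply; apply/eqP/ffunP => i; rewrite ffunE; apply/val_inj => /=.
  by rewrite -(eqP (h i)).
pose K' (z : state) : R := \sum_x (at_state (fun i => ycoord z i + inc x i)%N y)%:R *
  w s (ycoord z) (inc x).
have insert (rho : {ffun 'I_s -> X}) : \sum_x pathw (frcons rho x) * (at_state (posn (frcons rho x) s.+1) y)%:R =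
    (o s.+1 (ycoord y))%:R * \sum_z pathw rho * (at_state (posn rho s) z)%:R * K' z.
  have [ [z0 hz0] | nz ] := pselect (exists z, at_state (posn rho s) z).
    rewrite (bigD1 z0) //= [X in _ + X]big1 ?addr0; last first.
      move=> z zz0; rewrite (_ : at_state _ z = false) ?mulr0 ?mul0r //.
      by apply: contraNF zz0 => hz; rewrite (at_state_inj hz hz0).
    rewrite hz0 mulr1 mulrA mulr_sumr; apply: eq_bigr => x _.
    have pE : posn rho s = ycoord z0 by apply/at_stateP => // i; apply: posn_out.
    rewrite (_ : (fun i => _) = posn (frcons rho x) s.+1); last first.
      by apply/funext => i; rewrite posn_frcons_last pE.
    case: (boolP (at_state (posn (frcons rho x) s.+1) y)) => hy; last first.
      by rewrite mulr0 mul0r mulr0.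
    have hyE : posn (frcons rho x) s.+1 = ycoord y.
      by apply/at_stateP => // i; apply: posn_out.
    rewrite mulr1 mul1r /pathw big_ord_recr /= [X in _ * X]big_ord_recr /=.
    rewrite hyE posn_frcons // rowf_frcons_last pE.
    have -> : \prod_(i < s) w i (posn (frcons rho x) i) (rowf (frcons rho x) i) =
              \prod_(i < s) w i (posn rho i) (rowf rho i).
      by apply: eq_bigr => r _; rewrite posn_frcons ?rowf_frcons // ltnW.
    have -> : \prod_(i < s.+1) (o i (posn (frcons rho x) i))%:R =
              \prod_(i < s.+1) (o i (posn rho i))%:R :> R.
      by apply: eq_bigr => r _; rewrite posn_frcons // -ltnS.
    ring.
  rewrite [X in _ = _ * X]big1 ?mulr0; last first.
    move=> z _; rewrite (_ : at_state _ z = false) ?mulr0 ?mul0r //.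
    by apply/negP => h; apply: nz; exists z.
  (* Positions only increase: a trajectory already outside the bounded range cannot end at [y]. *)
  apply: big1 => x _; rewrite (_ : at_state _ y = false) ?mulr0 //.
  apply/negP => hy; apply: nz.
  have hyE : posn (frcons rho x) s.+1 = ycoord y.
    by apply/at_stateP => // i; apply: posn_out.
  exists [ffun i : 'I_n => inord (posn rho s i.+1)].
  apply/forallP => i; rewrite ffunE inordK // ltnS.
  have := ycoord_le y i.+1; rewrite -hyE posn_frcons_last; lia.
rewrite muS big_ffun_recr; under eq_bigr => rho _ do rewrite insert.
rewrite -mulr_sumr exchange_big /=; congr (_ * _); apply: eq_bigr => z _.
rewrite -mulr_suml IH; have [->|mz] := eqVneq (mu s z) 0; first by rewrite !mul0r.
congr (_ * _); rewrite /K'.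
have atE x : reflect (forall i, ycoord z i + inc x i = ycoord y i)%N
    (at_state (fun i => ycoord z i + inc x i)%N y).
  apply: (iffP (at_stateP _ _)) => [i hi|h i|h]; [|by rewrite -h|by apply/funext].
  by rewrite inc_out // addn0; case: i hi => // i hi; rewrite ycoord_out //; lia.
have [K0|Kn0] := eqVneq (K s z y) 0.
  rewrite K0 big1 // => x _; case: atE => [h|_]; last by rewrite mul0r.
  by rewrite (wK mz h) K0 mulr0.
have [x0 hx0] := Kx mz Kn0.
rewrite (bigD1 x0) //= [X in _ + X]big1 ?addr0.
  by case: atE => // _; rewrite mul1r (wK mz hx0).
move=> x xx0; case: atE => [h|_]; last by rewrite mul0r.
case/eqP: xx0; apply: inc_inj; apply/funext => i.
by have := h i; have := hx0 i; lia.
Qed.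

Definition bounded (f : nat -> nat) : bool := [forall i : 'I_n, (f i.+1 <= L)%N].

Lemma at_state_sum (f : nat -> nat) :
  \sum_(y : state) (at_state f y)%:R = (bounded f)%:R :> R.
Proof.
case: (boolP (bounded f)) => [/forallP bf|nb].
  pose y0 : state := [ffun i : 'I_n => inord (f i.+1)].
  have hy0 : at_state f y0 by apply/forallP => i; rewrite ffunE inordK // ltnS.
  rewrite (bigD1 y0) //= hy0 big1 ?addr0 // => y yy0.
  by case: (boolP (at_state f y)) yy0 => // h; rewrite (at_state_inj h hy0) eqxx.
apply: big1 => y _; case: (boolP (at_state f y)) => // /forallP h.
by case/forallP: nb => i; rewrite (eqP (h i)) leq_ord.
Qed.

Lemma path_mass s :
  \sum_(rho : {ffun 'I_s -> X}) pathw rho * (bounded (posn rho s))%:R = \sum_y mu s y.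
Proof.
under [RHS]eq_bigr => y _ do rewrite -path_sum.
rewrite exchange_big; apply: eq_bigr => rho _.
by rewrite -at_state_sum mulr_sumr.
Qed.

End PathSum.

(** * The q-TASEP side *)

Section QTasep.
Variables (R : realType) (q : R) (u a nu : nat -> R) (N T : nat -> nat) (M n : nat).
Hypothesis q01 : 0 < q < 1.
Hypothesis u_lt0 : forall i, (0 < i)%N -> u i < 0.
Hypothesis a_gt0 : forall i, (0 < i)%N -> 0 < a i.
Hypothesis gcol01 : forall k i, (0 < k)%N -> (0 < i)%N -> 0 <= gcol a nu k i < 1.
Hypothesis N_pos : forall s, (s < M)%N -> (0 < N s.+1)%N.

Definition stepp s (P g : nat -> nat) (i : nat) : R :=
  let gp := absz ((- (i.-1)%:Z + (P i.-1)%:Z) - (- i%:Z + (P i)%:Z) - 1)%R in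
  let j := g i in
  if T s.+1 == (T s).+1 then
    let beta := - u (T s.+1) in
    let r := a i * beta / (1 + a i * beta) in
    let rho := if (i == 1%N) || (g i.-1 == 1%N) then r else (1 - q ^+ gp) * r in
    if j == 0%N then 1 - rho else if j == 1%N then rho else 0
  else
    let alpha := nu (N s.+1) / a (N s.+1) in
    if i == 1%N then pinf q (a i * alpha) j else pfin q gp (a i * alpha) j.

Lemma stepwE (J : {ffun 'I_M * 'I_n -> nat}) s i :
  stepw q u a nu N T J s i = stepp s (fun i => \sum_(r < s) getJ J r i)%N (getJ J s) i.
Proof. by []. Qed.

Lemma stepw_ge0 (J : {ffun 'I_M * 'I_n -> nat}) s i : (s < M)%N -> (0 < i)%N ->
  0 <= stepw q u a nu N T J s i.
Proof.
move=> sM i0; rewrite stepwE /stepp; case: ifP => [/eqP TE|_]; last first.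
  have h := gcol01 (N_pos sM) i0.
  by case: ifP => _; [apply: pinf_ge0|apply: pfin_ge0].
have x0 : 0 < a i * - u (T s.+1).
  by rewrite mulr_gt0 ?a_gt0 // oppr_gt0 u_lt0 // TE.
set x := a i * - u (T s.+1) in x0 *; clearbody x.
have r01 : 0 <= x / (1 + x) <= 1.
  by rewrite divr_ge0 ?(ltW x0) //=; [rewrite ler_pdivrMr ?mul1r; lra|lra].
set r := x / (1 + x) in r01 *; clearbody r.
set gp := absz _; clearbody gp.
have g0 := ltW (expq_gt0 q01 gp); have g1 := expq_le1 q01 gp.
have : 0 <= (1 - q ^+ gp) * r <= 1.
  case/andP: r01 => r0 r1; rewrite mulr_ge0 //=; last by lra.
  by rewrite mulr_ile1 //; lra.
case/andP: r01 => r0 r1 /andP[s0 s1].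
by case: ifP => _; case: ifP => _; rewrite ?subr_ge0 //; case: ifP.
Qed.

Lemma tweight_ge0 (J : {ffun 'I_M * 'I_n -> nat}) : 0 <= tweight q u a nu N T J.
Proof.
apply: prodr_ge0 => s _; rewrite big_nat; apply: prodr_ge0 => i /andP[i0 _].
exact: stepw_ge0.
Qed.

Section Bounded.
Variables (L : nat) (kk : nat -> int).
Local Notation state := (state n L).

Definition toJ (rho : {ffun 'I_M -> state}) : {ffun 'I_M * 'I_n -> nat} :=
  [ffun p => rho p.1 p.2 : nat].

Lemma getJ_toJ rho s i : getJ (toJ rho) s i = rowf (@ycoord L n) rho s i.
Proof.
rewrite /getJ /rowf; case: insubP => // s' _ _.
case: i => [|i] /=; first by case: insubP.
have [i_n|i_n] := ltnP i n; last by rewrite ycoord_out // insubF //; lia.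
by rewrite (insubT (fun k => k < n)%N i_n) ffunE /= -(ycoordS _ (Ordinal i_n)).
Qed.

Definition wq s P g : R := \prod_(i < n) stepp s P g i.+1.

Lemma tweight_toJ rho :
  tweight q u a nu N T (toJ rho) =
  \prod_(s < M) wq s (posn (@ycoord L n) rho s) (rowf (@ycoord L n) rho s).
Proof.
apply: eq_bigr => s _; rewrite big_add1 big_mkord; apply: eq_bigr => i _.
rewrite stepwE; congr stepp.
  by apply/funext => j; apply: eq_bigr => r _; rewrite getJ_toJ.
by apply/funext => j; rewrite getJ_toJ.
Qed.

(** Order is what makes the absolute value in the trajectory gap agree with the truncated difference
    used by the kernels. *)
Lemma stepp_site s (y z x : state) (i : 'I_n) : ordered y ->
  (forall j, ycoord y j + ycoord x j = ycoord z j)%N ->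
  stepp s (ycoord y) (ycoord x) i.+1 =
  if T s.+1 == (T s).+1 then
    vsite q (xpar u a (T s.+1)) (fun=> 0) i.+1 (ycoord y i) (ycoord y i.+1)
      (ycoord z i) (ycoord z i.+1)
  else gsite q (gcol a nu (N s.+1)) (above 0) i.+1 (ycoord y i) (ycoord y i.+1) (ycoord z i.+1).
Proof.
move=> oy xE; rewrite /stepp /=.
have gE : (0 < i)%N -> absz ((- i%:Z + (ycoord y i)%:Z) - (- i.+1%:Z + (ycoord y i.+1)%:Z) - 1)%R =
    (ycoord y i - ycoord y i.+1)%N.
  by move=> i0; have := oy i i0; lia.
have E1 := xE i.+1; have E0 := xE i.
case: ifP => [/eqP TE|_]; last first.
  rewrite /gsite /above ltn0Sn -E1 leq_addr addKn /gcol.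
  by rewrite eqSS; case: ifP => // /negbT; rewrite -lt0n => /gE ->.
have x1 : 1 + a i.+1 * - u (T s.+1) != 0.
  by rewrite gt_eqF // addr_gt0 // mulr_gt0 ?a_gt0 // oppr_gt0 u_lt0 // TE.
rewrite /vsite /xpar -mulrN.
set X := a i.+1 * _ in x1 *.
have -> : (ycoord z i == (ycoord y i).+1) = (ycoord x i == 1%N) by lia.
have -> : (ycoord z i.+1 == ycoord y i.+1) = (ycoord x i.+1 == 0%N) by lia.
have -> : (ycoord z i.+1 == (ycoord y i.+1).+1) = (ycoord x i.+1 == 1%N) by lia.
rewrite eqSS; case: (posnP i) => [i0|i0].
  rewrite i0 /=; clearbody X.
  by case: ifP => _; [|case: ifP => // _]; rewrite /bw; field.
clearbody X; rewrite gE //; case: (_ == 1%N); rewrite ?(gtn_eqF i0) /=;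
  by case: ifP => _; [|case: ifP => // _]; rewrite /bw; field.
Qed.

Definition oq s (P : nat -> nat) : bool := (P (N s))%:Z == kk s.

Lemma qmeas_mass :
  \sum_(rho : {ffun 'I_M -> state})
    (tweight q u a nu N T (toJ rho) *
     \prod_(r < M.+1) (oq r (posn (@ycoord L n) rho r))%:R) *
    (bounded n L (posn (@ycoord L n) rho M))%:R =
  \sum_(y : state) qmeas q u a nu N T kk M y.
Proof.
have wK s (y z x : state) : qmeas q u a nu N T kk s y != 0 ->
    (forall i, ycoord y i + ycoord x i = ycoord z i)%N ->
    wq s (ycoord y) (ycoord x) = qstep q u a nu N T s y z.
  move=> /(ordsupp_qmeas q01) oy xE; rewrite /wq /qstep.
  under eq_bigr => i _ do rewrite (stepp_site _ _ oy xE).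
  by case: ifP.
have Kx s (y z : state) : qmeas q u a nu N T kk s y != 0 ->
    qstep q u a nu N T s y z != 0 ->
    exists x : state, forall i, (ycoord y i + ycoord x i = ycoord z i)%N.
  move=> _ h.
  have yz i : (ycoord y i <= ycoord z i)%N.
    by move: h; rewrite /qstep; case: ifP => _ h; [have := vker_ge h|have := gker_ge h]; apply.
  exists [ffun i : 'I_n => inord (z i - y i)] => -[//|i].
  have [i_n|i_n] := ltnP i n; last by rewrite !ycoord_out.
  have := yz i.+1; rewrite !(ycoordS _ (Ordinal i_n)) ffunE inordK; first by lia.
  by rewrite ltnS (leq_trans (leq_subr _ _)) // leq_ord.
rewrite -(path_mass (w := wq) (o := oq) (K := qstep q u a nu N T) (inc := @ycoord L n)
   (mu := qmeas q u a nu N T kk) (@ycoord_outside L n) (@ycoord_funinj L n)) //.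
by apply: eq_bigr => rho _; rewrite tweight_toJ.
Qed.

Lemma toJ_inj : injective toJ.
Proof.
move=> r1 r2 h; apply/ffunP => s; apply/ffunP => i; apply/val_inj => /=.
by have /ffunP/(_ (s, i)) := h; rewrite !ffunE.
Qed.

End Bounded.

Local Open Scope classical_set_scope.

Section Infinite.
Variable k : 'I_M.+1 -> int.
Let kk s := k (inord s).
Let goodJ := [set J : {ffun 'I_M * 'I_n -> nat} |
  forall s : 'I_M.+1, pos J s (N s) + (N s)%:Z = k s].
Let goodrho L (rho : {ffun 'I_M -> state n L}) :=
  [forall r : 'I_M.+1, oq kk r (posn (@ycoord L n) rho r)] &&
  bounded n L (posn (@ycoord L n) rho M).

Lemma goodJ_toJ L (rho : {ffun 'I_M -> state n L}) :
  (forall r : 'I_M.+1, oq kk r (posn (@ycoord L n) rho r)) <-> goodJ (toJ rho).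
Proof.
have e (r : 'I_M.+1) : pos (toJ rho) r (N r) + (N r)%:Z =
    (posn (@ycoord L n) rho r (N r))%:Z.
  rewrite /pos addrAC addNr add0r; congr (Posz _).
  by apply: eq_bigr => r' _; rewrite getJ_toJ.
split => [h r|h r]; first by rewrite e; have /eqP -> := h r; rewrite /kk inord_val.
by rewrite /oq -e h /kk inord_val.
Qed.

Lemma esum_bounded L :
  \esum_(J in @toJ L @` [set rho : {ffun 'I_M -> state n L} | goodrho rho])
    (tweight q u a nu N T J)%:E =
  (\sum_(y : state n L) qmeas q u a nu N T kk M y)%:E.
Proof.
rewrite esum_image; last by move=> r1 r2 _ _; apply: toJ_inj.
rewrite esum_fset; last by move=> rho _; rewrite lee_fin tweight_ge0.
  rewrite -qmeas_mass -sumEFin.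
  rewrite -(@bigfs _ _ _ _ (index_enum _) (fun rho => goodrho rho)) ?index_enum_uniq //; last first.
    by move=> i _; rewrite mem_index_enum.
  rewrite [LHS]big_mkcond /=; apply: eq_bigr => rho _; rewrite /goodrho.
  have -> : \prod_(r < M.+1) (oq kk r (posn (@ycoord L n) rho r))%:R =
      [forall r : 'I_M.+1, oq kk r (posn (@ycoord L n) rho r)]%:R :> R.
    case: (boolP [forall r : 'I_M.+1, _]) => [/forallP h|].
      by rewrite big1 // => r _; rewrite h.
    rewrite negb_forall => /existsP[r /negbTE h].
    by rewrite (bigD1 r) //= h mul0r.
  case: (bounded n L _); last by rewrite andbF mulr0.
  by case: [forall r : 'I_M.+1, oq kk r (posn (@ycoord L n) rho r)]; rewrite /= ?mulr1 ?mulr0 ?mul0r.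
exact: finite_finset.
Qed.

Lemma esum_good_ge L :
  ((\sum_(y : state n L) qmeas q u a nu N T kk M y)%:E <=
   \esum_(J in goodJ) (tweight q u a nu N T J)%:E)%E.
Proof.
rewrite -esum_bounded; apply: ge_ereal_sup => _ [X [finX XI] <-].
apply: ereal_sup_ubound; exists X => //; split => // J /XI [rho /andP[/forallP h _] <-].
exact/goodJ_toJ.
Qed.

(** The infinite sum is a supremum over finite sets of trajectories, and each such set fits below
    some bound [L]. *)
Lemma esum_good_le (c : R) L0 :
  (forall L, (L0 <= L)%N -> \sum_(y : state n L) qmeas q u a nu N T kk M y <= c) ->
  (\esum_(J in goodJ) (tweight q u a nu N T J)%:E <= c%:E)%E.
Proof.
move=> hc; apply: ge_ereal_sup => _ [X [finX XI] <-].
have /finite_seqP[r Xr] := finX.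
(* The total of all jumps dominates every jump and every final displacement of the trajectory. *)
pose L := maxn L0 (\max_(J <- r) (\sum_p J p)%N).
apply: (@le_trans _ _ (\sum_(y : state n L) qmeas q u a nu N T kk M y)%:E); last first.
  by rewrite lee_fin hc // leq_maxl.
rewrite -esum_bounded; apply: ereal_sup_ubound; exists X => //; split => // J XJ.
have JL : (\sum_p J p <= L)%N.
  apply: leq_trans (leq_maxr _ _).
  by move: XJ; rewrite Xr => /= rJ; rewrite (big_rem J) //= leq_maxl.
have JpL p : (J p <= L)%N by apply: leq_trans JL; rewrite (bigD1 p) //= leq_addr.
pose rho : {ffun 'I_M -> state n L} := [ffun s => [ffun i => inord (J (s, i))]].
have rhoE : toJ rho = J.
  by apply/ffunP => -[s i]; rewrite !ffunE /= inordK // ltnS.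
exists rho => //; apply/andP; split.
  by apply/forallP; apply/goodJ_toJ; rewrite rhoE; apply: XI.
apply/forallP => i; apply: leq_trans JL.
rewrite /posn (eq_bigr (fun s : 'I_M => J (s, i))); last first.
  by move=> s _; rewrite rowfS ycoordS !ffunE inordK // ltnS.
rewrite (eq_bigr (fun p => J (p.1, p.2))); last by case.
rewrite -(pair_bigA _ (fun r i => J (r, i))) /=; apply: leq_sum => s _.
by rewrite (bigD1 i) //= leq_addr.
Qed.

End Infinite.
End QTasep.

(** * The vertex model, row by row *)

Section Counts.
Variables (R : realType) (q : R) (u a nu : nat -> R) (K Tm : nat).

(** Arrows that left column [x] to the right in the first [t] rows; at x = 0, the arrows entering
    from the boundary, one per row. *)
Definition cnt (f : {ffun 'I_K * 'I_Tm -> bool}) (x t : nat) : nat :=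
  if x is 0%N then t else (\sum_(r < t) getb f x r.+1)%N.

Definition lwt (f : {ffun 'I_K * 'I_Tm -> bool}) (x t : nat) : R :=
  Lw q (u t.+1) (a x.+1) (nu x.+1)
    (vert f x.+1 t) (hin f x.+1 t.+1) (vert f x.+1 t.+1) (getb f x.+1 t.+1).

Lemma hinE f x t : hin f x.+1 t.+1 + cnt f x t = cnt f x t.+1 :> nat.
Proof.
rewrite /hin /cnt; case: x => [|x]; first by [].

by rewrite /= big_ord_recr /= addnC.
Qed.

(** Arrow conservation. Nonzero weights are required because [vert] uses truncated subtraction. *)
Lemma vert_cnt f x t : (forall r, (r < t)%N -> lwt f x r != 0) ->
  (vert f x.+1 t + cnt f x.+1 t = cnt f x t)%N.
Proof.
elim: t => [|t IH] h; first by case: (x) => [|x'] //=; rewrite !big_ord0.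
have h1 := IH (fun r rt => h r (ltnW rt)).
rewrite -(hinE f x t) -h1 {1}/cnt big_ord_recr /= -/(cnt f x.+1 t).
have := h t (ltnSn t); rewrite /lwt /Lw; case: ifP => [_|/negbFE/eqP hh _].
  by rewrite eqxx.
by move: hh => /=; lia.
Qed.

End Counts.

Section BitRows.
Variables (R : realType) (n : nat).
Local Notation row := {ffun 'I_n -> bool}.

Definition incb (x : row) (i : nat) : nat :=
  if i is j.+1 then (if insub j is Some j' then x j' : nat else 0%N) else 0%N.

Lemma incbS (x : row) (i : 'I_n) : incb x i.+1 = x i.
Proof. by rewrite /incb valK. Qed.

Lemma incb_out (x : row) i : ~~ (0 < i <= n)%N -> incb x i = 0%N.
Proof. by case: i => // i h; rewrite /incb insubF //; lia. Qed.

Lemma incb_inj (x x' : row) : incb x = incb x' -> x = x'.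
Proof.
move=> h; apply/ffunP => i; have := congr1 (fun f => f i.+1) h.
by rewrite !incbS; case: (x i); case: (x' i).
Qed.

Lemma incb_le1 (x : row) i : (incb x i <= 1)%N.
Proof. by case: i => // i; rewrite /incb; case: insub => // j; apply: leq_b1. Qed.

Definition toF t (rho : {ffun 'I_t -> row}) : {ffun 'I_n * 'I_t -> bool} :=
  [ffun p => rho p.2 p.1].

Lemma sum_toF t (F : {ffun 'I_n * 'I_t -> bool} -> R) :
  \sum_f F f = \sum_(rho : {ffun 'I_t -> row}) F (toF rho).
Proof.
rewrite (reindex (@toF t)) //.
exists (fun f : {ffun 'I_n * 'I_t -> bool} => [ffun r => [ffun i => f (i, r)]]).
  by move=> rho _; apply/ffunP => r; apply/ffunP => i; rewrite !ffunE.
by move=> f _; apply/ffunP => -[i r]; rewrite !ffunE.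
Qed.

Lemma getb_toF t (rho : {ffun 'I_t -> row}) x r : (0 < x)%N ->
  getb (toF rho) x r.+1 = rowf incb rho r x :> nat.
Proof.
case: x => // x _; rewrite /getb /rowf /incb /=.
case: insubP => [x' _ xE|]; last by case: insub.
by case: insubP => [r' _ rE|_] //; rewrite ffunE.
Qed.

Lemma cnt_toF t (rho : {ffun 'I_t -> row}) x r : (0 < x)%N ->
  cnt (toF rho) x r = posn incb rho r x.
Proof. by case: x => // x _; apply: eq_bigr => r' _; rewrite getb_toF. Qed.

End BitRows.

Arguments incb : simpl never.

Section VertexRows.
Variables (R : realType) (q : R) (u a nu : nat -> R) (n : nat).
Hypothesis q01 : 0 < q < 1.
Hypothesis u_lt0 : forall i, (0 < i)%N -> u i < 0.
Hypothesis a_gt0 : forall i, (0 < i)%N -> 0 < a i.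
Hypothesis nu1 : nu 1%N = 0.
Local Notation row := {ffun 'I_n -> bool}.
Local Notation incb := (@incb n).

Definition wv t (P g : nat -> nat) : R :=
  \prod_(i < n) vsite q (xpar u a t.+1) (numask nu 1 n) i.+1
    (P i) (P i.+1) (P i + g i)%N (P i.+1 + g i.+1)%N.

(** By conservation the number of vertical arrows is the gap. In column 1 an arrow always enters and
    nu = 0, so the weight is independent of that number and the conventional gap 0 does no harm. *)
Lemma lwt_vsite t (rho : {ffun 'I_t -> row}) r (i : 'I_n) :
  (vert (toF rho) i.+1 r + cnt (toF rho) i.+1 r = cnt (toF rho) i r)%N ->
  lwt q u a nu (toF rho) i r =
  vsite q (xpar u a r.+1) (numask nu 1 n) i.+1
    (posn incb rho r i) (posn incb rho r i.+1)
    (posn incb rho r i + rowf incb rho r i)%N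
    (posn incb rho r i.+1 + rowf incb rho r i.+1)%N.
Proof.
rewrite /lwt /vsite => cons; 
have e0 (m g : nat) : (m + g == m)%N = (g == 0%N) by lia.
have e1 (m g : nat) : (m + g == m.+1)%N = (g == 1%N) by lia.
rewrite !e0 !e1 {e0 e1}.
rewrite -(getb_toF rho r (ltn0Sn i)) -(cnt_toF rho r (ltn0Sn i)).
have x1 : 1 + xpar u a r.+1 i.+1 != 0.
  by rewrite gt_eqF // addr_gt0 // /xpar -mulrN mulr_gt0 ?a_gt0 // oppr_gt0 u_lt0.
have x1' : 1 - a i.+1 * u r.+1 != 0 by move: x1.
rewrite /= /Lw.
set g := vert _ _ _ in cons *; set b := getb _ _ _.
have [h [hE hb]] : exists h : bool, hin (toF rho) i.+1 r.+1 = h /\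
   (i.+1 == 1%N) || (rowf incb rho r i == 1%N) = h.
  rewrite /hin eqSS; case: (posnP i) => [i0|i0]; first by exists true.
  exists (getb (toF rho) i r.+1); split => //=.
  by rewrite -getb_toF //; case: (getb _ _ _).
rewrite hE hb.
have gE : (0 < i)%N ->
    (posn incb rho r i - cnt (toF rho) i.+1 r = g)%N.
  by move=> i0; rewrite -(cnt_toF rho r i0) -cons addnK.
have nuE : (0 < i)%N -> numask nu 1 n i.+1 = nu i.+1.
  by move=> i0; rewrite /numask ltnS i0 ltn_ord.
clearbody b g.
case: (posnP i) => [i0|i0].
  have hT : h by rewrite -hb i0.
  have -> : numask nu 1 n i.+1 = 0 by rewrite /numask i0.
  have -> : nu i.+1 = 0 by rewrite i0.
  rewrite hT /xpar in x1 *; case: b => /=.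
    by rewrite (_ : _ != _ = false) ?addn1 ?subn1 ?addn1 /bw ?eqxx //= mul0r; field.
  by rewrite (_ : _ != _ = false) ?addn0 ?subn0 ?addn0 /bw ?eqxx //= mul0r; field.
rewrite nuE // gE //.
clear gE nuE hE hb; rewrite /xpar in x1 *; move: (nu i.+1) (a i.+1 * u r.+1) x1 x1' => v X x1 x1'.
case: h; case: b => /=.
- by rewrite (_ : _ != _ = false) /bw; [field|lia].
- by rewrite (_ : _ != _ = false) /bw; [field|lia].
(* An arrow cannot leave an empty vertex: [Lw] vanishes by conservation, [bw] through the factor 1 -
   q^0. *)
- case: g cons => [|g] cons; first by rewrite /bw expr0 subrr mulr0 mul0r.
  by rewrite (_ : _ != _ = false) /bw; [field|lia].
- by rewrite (_ : _ != _ = false) /bw; [field|lia].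
Qed.

Lemma vweight_toF t (rho : {ffun 'I_t -> row}) :
  vweight q u a nu (toF rho) = \prod_(r < t) wv r (posn incb rho r) (rowf incb rho r).
Proof.
rewrite /vweight exchange_big /=.
suff h m : \prod_(r < m) \prod_(i < n) lwt q u a nu (toF rho) i r =
    \prod_(r < m) wv r (posn incb rho r) (rowf incb rho r) by rewrite -h.
elim: m => [|m IH]; first by rewrite !big_ord0.
rewrite !big_ord_recr /= IH.
(* Conservation in the earlier rows is available only if their weights are nonzero; otherwise both
   products are 0. *)
have [->|nz] := eqVneq (\prod_(r < m) wv r (posn incb rho r) (rowf incb rho r)) 0.
  by rewrite !mul0r.
congr (_ * _); apply: eq_bigr => i _; apply: lwt_vsite; apply: vert_cnt => r rm.
rewrite -IH in nz.
exact: (prod_neq0 (prod_neq0 nz (Ordinal rm)) i).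
Qed.

End VertexRows.

Section VertexMeasure.
Variables (R : realType) (q : R) (u a nu : nat -> R) (n L : nat).
Variables (N T : nat -> nat) (M : nat) (kk : nat -> int).
Hypothesis q01 : 0 < q < 1.
Hypothesis u_lt0 : forall i, (0 < i)%N -> u i < 0.
Hypothesis a_gt0 : forall i, (0 < i)%N -> 0 < a i.
Hypothesis nu1 : nu 1%N = 0.
Hypotheses (N0 : N 0%N = 1%N) (T0 : T 0%N = 0%N).
Hypothesis path : forall s, (s < M)%N ->
  (N s.+1 = (N s).+1 /\ T s.+1 = T s) \/ (N s.+1 = N s /\ T s.+1 = (T s).+1).
Local Notation state := (state n L).

Definition ov s t (P : nat -> nat) : bool :=
  [forall r : 'I_s.+1, (T r == t) ==> ((P (N r))%:Z == kk r)].

(** [vmeas] indexed by rows instead of path steps: all observations up to step [s] made at height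
    [t] are imposed together. *)
Fixpoint vmu s t : state -> R :=
  if t is t'.+1 then fun y => (ov s t (ycoord y))%:R * act (vmu s t') (vrow q u a nu t 1 n) y
  else fun y => (ov s 0 (ycoord y))%:R * origin R y.

Lemma ovP s t P :
  reflect (forall r, (r <= s)%N -> T r = t -> (P (N r))%:Z = kk r) (ov s t P).
Proof.
apply: (iffP forallP) => [h r rs Tr|h r].
  by apply/eqP; have := h (Ordinal (rs : (r < s.+1)%N)) => /implyP; apply; apply/eqP.
by apply/implyP => /eqP Tr; apply/eqP/h => //; rewrite -ltnS.
Qed.

Lemma ovS s t P :
  ov s.+1 t P = ov s t P && ((T s.+1 == t) ==> ((P (N s.+1))%:Z == kk s.+1)).
Proof.
apply/ovP/andP => [h|[/ovP h1 /implyP h2] r].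
  split; first by apply/ovP => r rs; apply: h; apply: leqW.
  by apply/implyP => /eqP Tr; apply/eqP/h.
rewrite leq_eqVlt => /predU1P[->|rs]; last exact: h1.
by move=> /eqP Tr; apply/eqP/h2.
Qed.

Lemma eq_vmu s s' t : (forall t' P, (t' <= t)%N -> ov s t' P = ov s' t' P) ->
  vmu s t = vmu s' t.
Proof.
elim: t => [|t IH] h; apply/funext => y /=; rewrite h //.
by rewrite IH // => t' P t't; apply: h; apply: leqW.
Qed.

Lemma vmeas_vmu s : (s <= M)%N -> vmeas q u a nu N T kk s = vmu s (T s).
Proof.
elim: s => [|s IH] sM.
  rewrite T0; apply/funext => y /=; rewrite /obs; congr ((nat_of_bool _)%:R * _).
  apply/eqP/ovP => [h r|h]; last by apply: h.
  by rewrite leqn0 => /eqP ->.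
have IHs := IH (ltnW sM).
case: (path sM) => -[NE TE].
  rewrite /= TE (_ : (T s == (T s).+1) = false); last by lia.
  rewrite IHs; apply/funext => y; rewrite /obs.
  have lower t : (t < T s)%N -> vmu s.+1 t = vmu s t.
    move=> tT; apply: eq_vmu => t' P t't; rewrite ovS (_ : (_ == t') = false) ?andbT //.
    by lia.
  case E : (T s) lower => [|t] lower /=; rewrite ovS TE E eqxx /= -mulnb natrM -mulrA mulrCA //.
  by rewrite lower.
rewrite /= TE eqxx IHs; apply/funext => y; rewrite /obs /=.
have -> : vmu s.+1 (T s) = vmu s (T s).
  apply: eq_vmu => t' P t't; rewrite ovS (_ : (_ == t') = false) ?andbT //.
  by lia.
congr ((nat_of_bool _)%:R * _); rewrite ovS TE eqxx /=.
rewrite (_ : ov s _ _ = true) //; apply/ovP => r rs Tr.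
by have := T_mono N0 path rs (ltnW sM); lia.
Qed.

Lemma vmeas_mass : (T M <= L)%N ->
  \sum_(f : {ffun 'I_n * 'I_(T M) -> bool})
    vweight q u a nu f * [forall s : 'I_M.+1, (cnt f (N s) (T s))%:Z == kk s]%:R =
  \sum_(y : state) vmeas q u a nu N T kk M y.
Proof.
move=> TL; rewrite vmeas_vmu // sum_toF.
rewrite -(path_mass (w := wv q u a nu n) (o := ov M)
   (K := fun t => vrow q u a nu t.+1 1 n) (inc := @incb n)
   (mu := vmu M) (@incb_out n) (@incb_inj n)) //; first last.
- move=> t y z _ h.
  exists [ffun i : 'I_n => z i != y i] => -[//|i].
  have [i_n|i_n] := ltnP i n; last by rewrite !ycoord_out // incb_out //; lia.
  rewrite (incbS _ (Ordinal i_n)) ffunE; have := prod_neq0 h (Ordinal i_n).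
  rewrite /vsite /= !(ycoordS _ (Ordinal i_n)) -[_ != _]/(_ != _).
  have -> : (z (Ordinal i_n) != y (Ordinal i_n)) = (z (Ordinal i_n) != y (Ordinal i_n) :> nat) by [].
  case: ((z (Ordinal i_n) : nat) =P (y (Ordinal i_n) : nat)) => [->|ne]; first by rewrite addn0.
  case: ((z (Ordinal i_n) : nat) =P (y (Ordinal i_n)).+1) => [->|_]; first by rewrite addn1.
  by rewrite eqxx.
- move=> t y z x _ h; apply: eq_bigr => i _.
  by rewrite !h.
apply: eq_bigr => rho _.
rewrite vweight_toF // /pathw -!mulrA; congr (_ * _).
(* Each of the [T M] rows moves a site by at most one, so nothing is truncated. *)
rewrite (_ : bounded _ _ _ = true) ?mulr1; last first.
  apply/forallP => i; apply: leq_trans TL.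
  rewrite /posn -[X in (_ <= X)%N]card_ord -sum1_card; apply: leq_sum => r _.
  by rewrite rowfS incb_le1.
have cE (s : 'I_M.+1) : cnt (toF rho) (N s) (T s) = posn (@incb n) rho (T s) (N s).
  by rewrite cnt_toF //; apply: (N_gt0 N0 path); rewrite -ltnS.
case: (boolP [forall s : 'I_M.+1, _]) => [/forallP h|].
  rewrite big1 // => t _; rewrite (_ : ov _ _ _ = true) //; apply/ovP => r rM Tr.
  by rewrite -Tr -(cE (Ordinal (rM : (r < M.+1)%N))); apply/eqP/h.
rewrite negb_forall => /existsP[s ns]; symmetry.
have Ts : (T s < (T M).+1)%N by rewrite ltnS (T_mono N0 path) // -ltnS.
rewrite (bigD1 (Ordinal Ts)) //= (_ : ov _ _ _ = false) ?mul0r //.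
apply/negP => /ovP h; move/negP: ns; apply; rewrite cE; apply/eqP/h => //.
by rewrite -ltnS.
Qed.

End VertexMeasure.

(** * The vertex model, column by column *)

Lemma incb_frcons n (c : {ffun 'I_n -> bool}) (b : bool) t : (t <= n)%N ->
  incb (frcons c b) t = incb c t.
Proof.
case: t => // t tn; rewrite /incb.
have tn1 : (t < n.+1)%N by lia.
rewrite (insubT (fun k => k < n)%N tn) (insubT (fun k => k < n.+1)%N tn1) /= ffunE.
case: unliftP => [j jE|jE].
  suff -> : j = Ordinal tn by [].
  by apply/val_inj; rewrite /= -(lift_max j) -jE.
by move/(congr1 val): jE => /=; lia.
Qed.

Lemma incb_frcons_last n (c : {ffun 'I_n -> bool}) (b : bool) :
  incb (frcons c b) n.+1 = b.
Proof. by rewrite (incbS (frcons c b) ord_max) ffunE unlift_none. Qed.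

Section AddColumn.
Variables (R : realType) (K Tm : nat).
Implicit Types (f : {ffun 'I_K * 'I_Tm -> bool}) (c : {ffun 'I_Tm -> bool}).

Definition ext f c : {ffun 'I_K.+1 * 'I_Tm -> bool} :=
  [ffun p => if unlift ord_max p.1 is Some j then f (j, p.2) else c p.2].

Lemma sum_ext (F : {ffun 'I_K.+1 * 'I_Tm -> bool} -> R) :
  \sum_f' F f' = \sum_f \sum_c F (ext f c).
Proof.
rewrite pair_big (reindex (fun p => ext p.1 p.2)) //=.
exists (fun f' : {ffun 'I_K.+1 * 'I_Tm -> bool} =>
  ([ffun p => f' (lift ord_max p.1, p.2)], [ffun t => f' (ord_max, t)])).
  move=> [f c] _ /=; congr pair.
    by apply/ffunP => -[x t]; rewrite !ffunE /= liftK.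
  by apply/ffunP => t; rewrite !ffunE /= unlift_none.
move=> f' _; apply/ffunP => -[x t]; rewrite !ffunE /=.
by case: unliftP => [j ->|->]; rewrite ?ffunE.
Qed.

Lemma getb_ext f c x t : (x <= K)%N -> getb (ext f c) x t = getb f x t.
Proof.
rewrite /getb; case: x => [_|x xK] /=; first by repeat case: insub => [?|] //.
have xK1 : (x < K.+1)%N by lia.
rewrite (insubT (fun k => k < K)%N xK) (insubT (fun k => k < K.+1)%N xK1) /=.
case: insubP => // t' _ _; case: ifP => // _; rewrite ffunE /=.
case: unliftP => [j jE|jE].
  suff -> : j = Ordinal xK by [].
  by apply/val_inj; rewrite /= -(lift_max j) -jE.
by move/(congr1 val): jE => /=; lia.
Qed.

Lemma getb_ext_last f c t : getb (ext f c) K.+1 t = incb c t :> nat.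
Proof.
rewrite /getb /= (insubT (fun k => k < K.+1)%N (ltnSn K)) /=.
case: t => [|t]; first by case: insubP.
rewrite /incb /=; case: insubP => // t' _ _; rewrite ffunE /=.
case: unliftP => // j jE; have := lift_max j; have := ltn_ord j.
by rewrite -jE /=; lia.
Qed.

Lemma hin_ext f c x t : (x <= K.+1)%N -> hin (ext f c) x t = hin f x t.
Proof. by move=> xK; rewrite /hin; case: ifP => // _; rewrite getb_ext //; lia. Qed.

Lemma vert_ext f c x t : (x <= K)%N -> vert (ext f c) x t = vert f x t.
Proof.
move=> xK; elim: t => //= t ->.
by rewrite hin_ext ?getb_ext // leqW.
Qed.

Lemma cnt_ext f c x t : (x <= K)%N -> cnt (ext f c) x t = cnt f x t.
Proof.
by case: x => // x xK; apply: eq_bigr => r _; rewrite getb_ext.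
Qed.

End AddColumn.

Fixpoint vcol (h b : nat -> nat) (t : nat) : nat :=
  if t is r.+1 then (vcol h b r + h t - b t)%N else 0%N.

Lemma vert_vcol K Tm (f : {ffun 'I_K * 'I_Tm -> bool}) x t :
  vert f x t = vcol (hin f x) (fun t => getb f x t) t.
Proof. by elim: t => //= t ->. Qed.

Lemma eq_vcol h b b' m : (forall t, (t <= m)%N -> b t = b' t) -> vcol h b m = vcol h b' m.
Proof. by elim: m => //= m IH e; rewrite IH ?e // => t tm; apply: e; apply: leqW. Qed.

Section Columns.
Variables (R : realType) (q : R) (u a nu : nat -> R).
Hypothesis q01 : 0 < q < 1.
Hypothesis u_lt0 : forall i, (0 < i)%N -> u i < 0.
Hypothesis a_gt0 : forall i, (0 < i)%N -> 0 < a i.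
Hypothesis nu01 : forall i, (0 < i)%N -> 0 <= nu i <= 1.

Lemma den_gt0 x t : (0 < x)%N -> (0 < t)%N -> 0 < 1 - a x * u t.
Proof.
by move=> x0 t0; rewrite subr_gt0 (lt_trans _ ltr01) // pmulr_rlt0 ?a_gt0 // u_lt0.
Qed.

Lemma Lw_sum x t g h : (0 < x)%N -> (0 < t)%N -> (h <= 1)%N ->
  Lw q (u t) (a x) (nu x) g h (g + h) 0 + Lw q (u t) (a x) (nu x) g h (g + h - 1) 1 = 1.
Proof.
move=> x0 t0; have := den_gt0 x0 t0; rewrite /Lw addn0 eqxx /=.
set X := a x * u t => X0; have X1 : 1 - X != 0 by rewrite gt_eqF.
clearbody X; case: h => [|[|]] // _; last first.
  by rewrite (_ : (g + 1 != g + 1 - 1 + 1)%N = false); [field|lia].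
(* For g = h = 0 the subtraction of 1 is truncated; the second weight vanishes and the first equals
   1. *)
rewrite !addn0; case: g => [|g]; first by rewrite /= expr0 mulr1 addr0 divff.
by rewrite (_ : (_ != _ - 1 + 1)%N = false); [field|lia].
Qed.

Lemma Lw_ge0 x t g h g' b : (0 < x)%N -> (0 < t)%N ->
  0 <= Lw q (u t) (a x) (nu x) g h g' b.
Proof.
move=> x0 t0; have := den_gt0 x0 t0; rewrite /Lw; case: ifP => // _.
have X0 : a x * u t <= 0 by rewrite mulr_ge0_le0 // ltW ?a_gt0 ?u_lt0.
have /andP[n0 n1] := nu01 x0.
have g0 := ltW (expq_gt0 q01 g); have g1 := expq_le1 q01 g.
set X := a x * u t in X0 * => X1; clearbody X.
have h1 : 0 <= nu x * q ^+ g by apply: mulr_ge0.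
have h2 : nu x * q ^+ g <= 1 by apply: mulr_ile1.
have h3 : X * q ^+ g <= 0 by rewrite mulr_le0_ge0.
case: h => [|[|]] //; case: b => [|[|]] //; rewrite divr_ge0 ?(ltW X1) //; try lra.
by rewrite mulr_ge0 //; lra.
Qed.

Definition colw m x (h b : nat -> nat) : R :=
  \prod_(t < m) Lw q (u t.+1) (a x) (nu x) (vcol h b t) (h t.+1) (vcol h b t.+1) (b t.+1).

Lemma colw_sum m x h : (0 < x)%N -> (forall t, (h t <= 1)%N) ->
  \sum_(c : {ffun 'I_m -> bool}) colw m x h (incb c) = 1.
Proof.
move=> x0 h1; elim: m => [|m IH].
  rewrite (big_pred1 [ffun => false]) /colw ?big_ord0 // => c.
  by symmetry; apply/eqP/ffunP => -[].
rewrite big_ffun_recr -[RHS]IH; apply: eq_bigr => c _.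
have e (b : bool) t : (t <= m)%N -> vcol h (incb (frcons c b)) t = vcol h (incb c) t.
  by move=> tm; apply: eq_vcol => r rt; rewrite incb_frcons //; lia.
have eb (b : bool) : colw m.+1 x h (incb (frcons c b)) = colw m x h (incb c) *
    Lw q (u m.+1) (a x) (nu x) (vcol h (incb c) m) (h m.+1) (vcol h (incb c) m + h m.+1 - b) b.
  rewrite /colw big_ord_recr /=; congr (_ * _); last by rewrite e // incb_frcons_last.
  by apply: eq_bigr => t _; rewrite !e ?incb_frcons // ltnW.
by rewrite big_bool /= !eb /= subn0 -mulrDr addrC Lw_sum // mulr1.
Qed.

Lemma colw_empty m x h : (0 < x)%N -> (forall t, (t < m)%N -> h t.+1 = 0%N) ->
  colw m x h (fun=> 0%N) = 1.
Proof.
move=> x0 h0; rewrite /colw big1 // => t _.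
have v0 r : (r <= m)%N -> vcol h (fun=> 0%N) r = 0%N.
  by elim: r => //= r IH rm; rewrite IH ?h0 // ltnW.
rewrite !v0 ?h0 // 1?ltnW // /Lw /= expr0 mulr1 divff // gt_eqF //.
exact: den_gt0.
Qed.

Lemma colw_keep m x h e : (0 < x)%N -> (forall t, (h t <= 1)%N) -> 0 <= e ->
  (forall t g j, (t < m)%N -> (j <= 1)%N -> e <= Lw q (u t.+1) (a x) (nu x) g j (g + j) 0) ->
  e ^+ m <= colw m x h (fun=> 0%N).
Proof.
move=> x0 h1 e0 he; rewrite -[m in leLHS]card_ord -prodr_const /colw.
by apply: ler_prod => t _; rewrite e0 /= subn0; apply: he.
Qed.

Lemma vweight_ext K Tm (f : {ffun 'I_K * 'I_Tm -> bool}) c :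
  vweight q u a nu (ext f c) =
  vweight q u a nu f * colw Tm K.+1 (hin f K.+1) (incb c).
Proof.
rewrite /vweight big_ord_recr /=; congr (_ * _).
  apply: eq_bigr => x _; apply: eq_bigr => t _.
  by rewrite !vert_ext ?hin_ext ?getb_ext // leqW.
apply: eq_bigr => t _.
have e r : vert (ext f c) K.+1 r = vcol (hin f K.+1) (incb c) r.
  rewrite vert_vcol; elim: r => //= r ->.
  by rewrite hin_ext // getb_ext_last.
by rewrite !e hin_ext // getb_ext_last.
Qed.

Lemma vweight_ge0 K Tm (f : {ffun 'I_K * 'I_Tm -> bool}) : 0 <= vweight q u a nu f.
Proof. by apply: prodr_ge0 => x _; apply: prodr_ge0 => t _; apply: Lw_ge0. Qed.

Lemma hin_le1 K Tm (f : {ffun 'I_K * 'I_Tm -> bool}) x t : (hin f x t <= 1)%N.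
Proof. by rewrite /hin; case: ifP => // _; apply: leq_b1. Qed.

(** Stochastic weights make the models in growing boxes consistent: the last column sums to 1. *)
Lemma vweight_marginal K Tm (G : {ffun 'I_K.+1 * 'I_Tm -> bool} -> R)
    (G' : {ffun 'I_K * 'I_Tm -> bool} -> R) :
  (forall f c, G (ext f c) = G' f) ->
  \sum_f vweight q u a nu f * G f = \sum_f vweight q u a nu f * G' f.
Proof.
move=> GE; rewrite sum_ext; apply: eq_bigr => f _.
under eq_bigr => c _ do rewrite vweight_ext GE mulrAC.
by rewrite -mulr_sumr colw_sum ?mulr1 // => t; apply: hin_le1.
Qed.

Lemma vweight_sum K Tm :
  \sum_(f : {ffun 'I_K * 'I_Tm -> bool}) vweight q u a nu f = 1.
Proof.
elim: K => [|K IH].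
  rewrite (big_pred1 [ffun => false]); last first.
    by move=> f; symmetry; apply/eqP/ffunP => -[[]].
  by rewrite /vweight big_ord0.
rewrite -[RHS]IH.
have := @vweight_marginal K Tm (fun=> 1) (fun=> 1) (fun _ _ => erefl).
by under eq_bigr do rewrite mulr1; under [in X in _ = X]eq_bigr do rewrite mulr1.
Qed.

Definition escapes K Tm (f : {ffun 'I_K * 'I_Tm -> bool}) : bool :=
  [exists t : 'I_Tm, getb f K t.+1].

(** If no arrow enters column K + 1, none leaves it; otherwise all rows keep their arrows with
    probability at least e^Tm. For K = 0 arrows would enter from the boundary. *)
Lemma escape_le K Tm e : (0 < K)%N -> 0 <= e ->
  (forall t g j, (t < Tm)%N -> (j <= 1)%N ->
     e <= Lw q (u t.+1) (a K.+1) (nu K.+1) g j (g + j) 0) ->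
  \sum_(f : {ffun 'I_K.+1 * 'I_Tm -> bool}) vweight q u a nu f * (escapes f)%:R <=
  (1 - e ^+ Tm) *
  \sum_(f : {ffun 'I_K * 'I_Tm -> bool}) vweight q u a nu f * (escapes f)%:R.
Proof.
move=> K0 e0 he; rewrite sum_ext mulr_sumr; apply: ler_sum => f _.
pose h := hin f K.+1.
have h1 t : (h t <= 1)%N by apply: hin_le1.
have z0 : incb ([ffun => false] : {ffun 'I_Tm -> bool}) = fun=> 0%N.
  apply/funext => -[//|t]; rewrite /incb; case: insub => // t'.
  by rewrite ffunE.
have -> : \sum_c vweight q u a nu (ext f c) * (escapes (ext f c))%:R =
    vweight q u a nu f * (1 - colw Tm K.+1 h (fun=> 0%N)).
  transitivity (vweight q u a nu f * (\sum_(c : {ffun 'I_Tm -> bool}) colw Tm K.+1 h (incb c) -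
      colw Tm K.+1 h (fun=> 0%N))); last by rewrite colw_sum.
  rewrite mulrBr mulr_sumr.
  rewrite (bigD1 [ffun => false]) //= [in RHS](bigD1 [ffun => false]) //= z0.
  rewrite addrAC subrr add0r (_ : escapes _ = false); last first.
    apply/existsP => -[t]; have := getb_ext_last f [ffun => false] t.+1.
    by rewrite z0; case: getb.
  rewrite mulr0 add0r; apply: eq_bigr => c c0.
  rewrite vweight_ext (_ : escapes _) ?mulr1 //.
  have [t ct] : exists t, c t.
    apply: contrapT => nt; move/negP: c0; apply; apply/eqP/ffunP => t; rewrite ffunE.
    by apply/negP => ct; apply: nt; exists t.
  apply/existsP; exists t; have := getb_ext_last f c t.+1; rewrite incbS ct.
  by case: getb.
rewrite mulrCA; apply: ler_wpM2l; first exact: vweight_ge0.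
case: (boolP (escapes f)) => [_|nf]; rewrite ?mulr1 ?mulr0.
  by rewrite lerB // colw_keep.
rewrite colw_empty ?subrr // => t tT.
rewrite /h /hin eqSS (gtn_eqF K0) /=.
apply/eqP; rewrite eqb0; apply: contraNN nf => ft.
by apply/existsP; exists (Ordinal tT).
Qed.

End Columns.

(** * Removing the truncations *)

Section Truncation.
Variables (R : realType) (q : R) (u a nu : nat -> R) (N T : nat -> nat) (M : nat).
Hypothesis q01 : 0 < q < 1.
Hypothesis u_lt0 : forall i, (0 < i)%N -> u i < 0.
Hypothesis a_gt0 : forall i, (0 < i)%N -> 0 < a i.
Hypothesis nu01 : forall i, (0 < i)%N -> 0 <= nu i <= 1.
Hypotheses (N0 : N 0%N = 1%N) (T0 : T 0%N = 0%N).
Hypothesis path : forall s, (s < M)%N ->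
  (N s.+1 = (N s).+1 /\ T s.+1 = T s) \/ (N s.+1 = N s /\ T s.+1 = (T s).+1).
Variable k : 'I_M.+1 -> int.

(** Conservation telescoped over the columns x + 1, ..., K: the box height misses exactly the arrows
    that have left the box. *)
Lemma hbox_cnt K Tm (f : {ffun 'I_K * 'I_Tm -> bool}) x t :
  vweight q u a nu f != 0 -> (x <= K)%N -> (t <= Tm)%N ->
  (hbox f x.+1 t + cnt f K t = cnt f x t)%N.
Proof.
move=> fn0 xK tT; rewrite /hbox.
have h y : (y < K)%N -> (vert f y.+1 t + cnt f y.+1 t = cnt f y t)%N.
  move=> yK; apply: (@vert_cnt R q u a nu) => r rt.
  have rT : (r < Tm)%N by apply: leq_trans tT.
  exact: (prod_neq0 (prod_neq0 fn0 (Ordinal yK)) (Ordinal rT)).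
suff gen j : (x + j <= K)%N ->
    (\sum_(x.+1 <= y < (x + j).+1) vert f y t + cnt f (x + j) t = cnt f x t)%N.
  by have := gen (K - x)%N; rewrite subnKC //; apply.
elim: j => [|j IH] jK; first by rewrite addn0 big_geq.
rewrite addnS big_nat_recr /=; last by lia.
by rewrite -addnA h; [apply: IH; lia|lia].
Qed.

(** The height replaced by the number of arrows that passed column [N s], which escaping arrows do
    not affect. *)
Definition ideal K Tm : R := \sum_(f : {ffun 'I_K * 'I_Tm -> bool})
  vweight q u a nu f * [forall s : 'I_M.+1, (cnt f (N s) (T s))%:Z == k s]%:R.

Definition escape_mass K Tm : R := \sum_(f : {ffun 'I_K * 'I_Tm -> bool})
  vweight q u a nu f * (escapes f)%:R.

Lemma ideal_stable K Tm : (N M <= K)%N -> ideal K Tm = ideal (N M) Tm.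
Proof.
elim: K => [|K IH]; first by rewrite leqn0 => /eqP ->.
rewrite leq_eqVlt => /predU1P[->//|NK]; rewrite -IH //.
apply: vweight_marginal => // f c; congr ((nat_of_bool _)%:R).
apply: eq_forallb => s; rewrite cnt_ext //; apply: leq_trans (NK : (N M <= K)%N).
by apply: (N_mono N0 path) => //; rewrite -ltnS.
Qed.

(** The two indicators can differ only when an arrow leaves column [K]. *)
Lemma PVbox_ideal K : (N M <= K)%N ->
  `|PVbox q u a nu N T K k - ideal K (T M)| <= escape_mass K (T M).
Proof.
move=> NK; rewrite /PVbox /ideal -sumrB.
apply: le_trans (ler_norm_sum _ _ _) _; apply: ler_sum => f _.
rewrite -mulrBr normrM ger0_norm ?vweight_ge0 //.
have [->|fn0] := eqVneq (vweight q u a nu f) 0; first by rewrite !mul0r.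
apply: ler_wpM2l; first exact: vweight_ge0.
case: (boolP (escapes f)) => [_|/existsPn nf].
  by do 2 case: [forall _, _]; rewrite ?subrr ?subr0 ?sub0r ?normrN ?normr1 ?normr0.
rewrite (_ : [forall s : 'I_M.+1, (hbox f (N s).+1 (T s))%:Z == k s] =
             [forall s : 'I_M.+1, (cnt f (N s) (T s))%:Z == k s]).
  by rewrite subrr normr0.
apply: eq_forallb => s; have sM : (s <= M)%N by rewrite -ltnS.
have Tle := T_mono N0 path sM (leqnn M).
rewrite -(hbox_cnt fn0 (leq_trans (N_mono N0 path sM (leqnn M)) NK) Tle).
suff -> : cnt f K (T s) = 0%N by rewrite addn0.
have : (0 < K)%N by apply: leq_trans NK; apply: (N_gt0 N0 path).
case: (K) f nf {fn0 NK} => // K' f nf _ /=; apply: big1 => r _.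
have rT : (r < T M)%N by apply: leq_trans Tle.
by apply/eqP; rewrite eqb0; apply: (nf (Ordinal rT)).
Qed.

Lemma escape_mass_geo e K Tm : 0 <= e -> e ^+ Tm <= 1 ->
  (forall x t g j, (1 < x)%N -> (t < Tm)%N -> (j <= 1)%N ->
     e <= Lw q (u t.+1) (a x) (nu x) g j (g + j) 0) ->
  escape_mass K.+1 Tm <= (1 - e ^+ Tm) ^+ K.
Proof.
move=> e0 e1 he; elim: K => [|K IH].
  rewrite expr0 -(@vweight_sum _ q u a nu q01 u_lt0 a_gt0 1 Tm); apply: ler_sum => f _.
  by rewrite ler_piMr ?vweight_ge0 // lern1 leq_b1.
rewrite exprS; apply: le_trans (escape_le _ _ _ _ _ e0 _) _ => //.
  by move=> t g j tT j1; apply: he.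
by apply: ler_wpM2l => //; rewrite subr_ge0.
Qed.

Local Open Scope classical_set_scope.

Lemma PVbox_cvg e : 0 < e <= 1 ->
  (forall x t g j, (1 < x)%N -> (t < T M)%N -> (j <= 1)%N ->
     e <= Lw q (u t.+1) (a x) (nu x) g j (g + j) 0) ->
  (fun K => PVbox q u a nu N T K k) @ \oo --> ideal (N M) (T M).
Proof.
move=> /andP[e0 e1] he.
have eT0 : 0 < e ^+ T M by apply: exprn_gt0.
have eT1 : e ^+ T M <= 1 by rewrite exprn_ile1 // ltW.
rewrite -(cvg_shiftS (fun K => PVbox q u a nu N T K k)).
apply/cvgrPdist_le => d d0.
have : (fun K => (1 - e ^+ T M) ^+ K) @ \oo --> (0 : R).
  by apply: cvg_expr; rewrite ger0_norm ?subr_ge0 // gtrBl.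
move=> /cvgrPdist_le /(_ d d0) near0; near=> K.
have NK : (N M <= K.+1)%N by near: K; exists (N M) => // m /= Nm; apply: leqW.
rewrite distrC -(ideal_stable (T M) NK); apply: le_trans (PVbox_ideal NK) _.
apply: le_trans (escape_mass_geo K (ltW e0) eT1 he) _.
have : `|0 - (1 - e ^+ T M) ^+ K| <= d by near: K.
by rewrite sub0r normrN ger0_norm // exprn_ge0 // subr_ge0.
Unshelve. all: by end_near. Qed.

End Truncation.

(** * Mass kept by the lower parts of the geometric moves *)

Section TotalMass.
Variables (R : realType) (q : R) (u a nu : nat -> R) (n L : nat).
Hypothesis q01 : 0 < q < 1.
Hypothesis n_gt0 : (0 < n)%N.
Hypothesis gcol01 : forall k i, (0 < k)%N -> (0 < i)%N -> 0 <= gcol a nu k i < 1.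
Local Notation state := (state n L).
Implicit Types p : state -> R.

Lemma lam_ge0 j p : (forall y, 0 <= p y) -> forall y, 0 <= lam q a nu j p y.
Proof.
move=> p0; elim: j => //= j IH; apply: act_ge0 => // y z; apply: gker_ge0 => // i i0.
exact: gcol01.
Qed.

Lemma mass_lam_le j p : (forall y, 0 <= p y) ->
  \sum_y lam q a nu j p y <= \sum_y p y.
Proof.
move=> p0; elim: j => //= j IH; apply: le_trans IH; apply: mass_act_le => //.
  exact: lam_ge0.
exact: gcol01.
Qed.

(** Each of the [j] moves is allowed to displace particle 1 by at most [l]. *)
Lemma massle_lam_ge j p B l : (forall y, 0 <= p y) -> (B + j * l <= L)%N ->
  (\prod_(i < j) \sum_(r < l.+1) pinf q (gcol a nu i.+2 1) r) * massle B p <=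
  massle (B + j * l) (lam q a nu j p).
Proof.
move=> p0; elim: j => [|j IH] BL; first by rewrite big_ord0 mul1r addn0.
have BL' : (B + j * l <= L)%N by move: BL; rewrite mulSn; lia.
have g01 := gcol01 (ltn0Sn j.+1) (ltn0Sn 0).
rewrite big_ord_recr /= mulrAC mulrC.
rewrite (_ : B + j.+1 * l = (B + j * l) + l)%N; last by rewrite mulSn; lia.
apply: le_trans (massle_act_ge _ _ _ _ _ _) => //; last first.
- by move: BL; rewrite mulSn; lia.
- exact: lam_ge0.
apply: ler_wpM2l; last exact: IH.
by apply: sumr_ge0 => r _; apply: pinf_ge0.
Qed.

End TotalMass.

Section VertexSupport.
Variables (R : realType) (q : R) (u a nu : nat -> R) (n L : nat).
Variables (N T : nat -> nat) (M : nat) (kk : nat -> int).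
Hypothesis q01 : 0 < q < 1.
Hypothesis u_lt0 : forall i, (0 < i)%N -> u i < 0.
Hypothesis a_gt0 : forall i, (0 < i)%N -> 0 < a i.
Hypothesis nu01 : forall i, (0 < i)%N -> 0 <= nu i <= 1.
Hypothesis Tstep : forall s, (s < M)%N -> T s.+1 = T s \/ T s.+1 = (T s).+1.
Local Notation state := (state n L).

Lemma vker_le x v (y z : state) : vker q x v y z != 0 ->
  forall i, (ycoord z i <= (ycoord y i).+1)%N.
Proof.
move=> h [//|i]; have [i_n|i_n] := ltnP i n; last by rewrite !ycoord_out.
have := prod_neq0 h (Ordinal i_n); rewrite /vsite /=.
case: (eqVneq (ycoord z i.+1)) => [-> //|_].
by case: (eqVneq (ycoord z i.+1)) => [-> //|_]; rewrite eqxx.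
Qed.

Lemma vmeas_ge0 s (y : state) : 0 <= vmeas q u a nu N T kk s y.
Proof.
elim: s y => [|s IH] y /=; rewrite /obs; apply: mulr_ge0 => //; rewrite ?/origin ?ler0n //.
case: ifP => // /eqP TE; apply: act_ge0 => // y' z; apply: vker_ge0 => // i i0.
  by rewrite /xpar oppr_ge0 mulr_ge0_le0 // ltW ?a_gt0 // u_lt0 // TE.
by rewrite /numask; case: ifP => _; [apply: nu01|rewrite lexx ler01].
Qed.

Lemma vmeas_supp s (y : state) : (s <= M)%N ->
  vmeas q u a nu N T kk s y != 0 -> forall i, (ycoord y i <= T s)%N.
Proof.
elim: s y => [|s IH] y sM /=; rewrite /obs mulf_eq0 negb_or => /andP[_] h i.
  move: h; rewrite /origin; case: (eqVneq y [ffun => ord0]) => [->|_].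
    by rewrite ycoord0.
  by rewrite eqxx.
case: (T s.+1 =P (T s).+1) h => [TE|nTE] h; last first.
  by apply: leq_trans (IH _ (ltnW sM) h i) _; case: (Tstep sM) => ->.
have [y'] : exists y', vmeas q u a nu N T kk s y' * vrow q u a nu (T s.+1) 1 n y' y != 0.
  apply: contrapT => nh; move/negP: h; apply; apply/eqP/big1 => y' _.
  by apply: contrapT => h; apply: nh; exists y'; apply/eqP.
rewrite mulf_eq0 negb_or => /andP[h1 h2].
by rewrite TE (leq_trans (vker_le h2 i)) // ltnS IH // ltnW.
Qed.

Lemma massle_vmeas : massle (T M) (vmeas q u a nu N T kk M : state -> R) =
  \sum_(y : state) vmeas q u a nu N T kk M y.
Proof.
apply: eq_bigr => y _; have [->|h] := eqVneq (vmeas q u a nu N T kk M y) 0.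
  by rewrite mul0r.
by rewrite vmeas_supp // mulr1.
Qed.

End VertexSupport.

(** * Identification of the two joint laws *)

Section Equality.
Local Open Scope classical_set_scope.
Local Open Scope ring_scope.
Variables (R : realType) (q : R) (u a nu : nat -> R) (N T : nat -> nat) (M : nat).
Hypothesis q01 : 0 < q < 1.
Hypothesis u_lt0 : forall i, (0 < i)%N -> u i < 0.
Hypothesis a_gt0 : forall i, (0 < i)%N -> 0 < a i.
Hypothesis nu01 : forall i, (0 < i)%N -> 0 <= nu i <= 1.
Hypothesis nu1 : nu 1%N = 0.
Hypothesis ac_lt1 : forall i j, (0 < i)%N -> (0 < j)%N -> a i * (nu j / a j) < 1.
Hypotheses (N0 : N 0%N = 1%N) (T0 : T 0%N = 0%N).
Hypothesis path : forall s, (s < M)%N ->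
  (N s.+1 = (N s).+1 /\ T s.+1 = T s) \/ (N s.+1 = N s /\ T s.+1 = (T s).+1).
Variable k : 'I_M.+1 -> int.

(** At the end of the path [phi] is empty, so the truncated q-TASEP mass is that of [lam] applied to
    the vertex measure. It never exceeds the vertex mass, and it recovers that mass as the bound
    grows. *)
Lemma PQ_ideal : PQ q u a nu N T k = (ideal q u a nu N T k (N M) (T M))%:E.
Proof.
set P := ideal _ _ _ _ _ _ _ _ _.
pose kk s := k (inord s).
have NM0 := N_gt0 N0 path (leqnn M).
have gcol01 m i : (0 < m)%N -> (0 < i)%N -> 0 <= gcol a nu m i < 1.
  move=> m0 i0; rewrite /gcol ac_lt1 // andbT.
  by rewrite mulr_ge0 ?divr_ge0 ?(ltW (a_gt0 _)) //; case/andP: (nu01 m0).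
have nu_ge0 i : (0 < i)%N -> 0 <= nu i by move=> /nu01/andP[].
have Npos s : (s < M)%N -> (0 < N s.+1)%N by move=> sM; apply: (N_gt0 N0 path).
have vP L : (T M <= L)%N -> \sum_(y : state (N M) L) vmeas q u a nu N T kk M y = P.
  move=> TL; rewrite -vmeas_mass //; apply: eq_bigr => f _; congr (_ * (nat_of_bool _)%:R).
  by apply: eq_forallb => s; rewrite /kk inord_val.
have qv L : qmeas q u a nu N T kk M =
    lam q a nu (N M).-1 (vmeas q u a nu N T kk M) :> (state (N M) L -> R).
  have := qmeas_vmeas L q01 u_lt0 a_gt0 nu_ge0 kk N0 T0 path (leqnn M) (leqnn (N M)).
  by rewrite subnn.
have le : (PQ q u a nu N T k <= P%:E)%E.
  apply: (esum_good_le q01 u_lt0 a_gt0 gcol01 Npos (L0 := T M)) => L TL.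
  by rewrite -/kk qv -(vP L TL); apply: mass_lam_le => // y; apply: vmeas_ge0.
apply/eqP; rewrite eq_le le /=.
pose c l : R := \prod_(i < (N M).-1) \sum_(r < l.+1) pinf q (gcol a nu i.+2 1) r.
have ge l : ((c l * P)%:E <= PQ q u a nu N T k)%E.
  (* The rows move particle 1 by at most [T M], and each of the [(N M).-1] geometric factors is
     granted a jump of at most [l]. *)
  pose L := (T M + (N M).-1 * l)%N.
  have TL : (T M <= L)%N by apply: leq_addr.
  have := esum_good_ge T (N M) q01 u_lt0 a_gt0 gcol01 Npos k L; apply: le_trans.
  rewrite lee_fin -/kk qv -massleL -(vP L TL).
  have vge (y : state (N M) L) : 0 <= vmeas q u a nu N T kk M y by apply: vmeas_ge0.
  have Tstep s : (s < M)%N -> T s.+1 = T s \/ T s.+1 = (T s).+1.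
    by move=> sM; case: (path sM) => -[_ ->]; [left|right].
  rewrite -(massle_vmeas q u a nu _ _ N kk Tstep).
  exact: (massle_lam_ge q01 NM0 gcol01 vge (leqnn L)).
have cP : (fun l => c l * P) @ \oo --> P.
  rewrite -[X in _ --> X]mul1r; apply: cvgMl; rewrite /c.
  elim: (N M).-1 => [|m IH].
    under eq_fun => l do rewrite big_ord0.
    exact: cvg_cst.
  under eq_fun => l do rewrite big_ord_recr /=.
  have h := cvgM IH (pinf_part_cvg q01 (gcol01 m.+2 1%N isT isT)).
  by rewrite mulr1 in h; exact: h.
case: (PQ q u a nu N T k) le ge => [r| |] // le ge.
- rewrite lee_fin; apply: (ler_cvg_to cP (cvg_cst r)); near=> l.
  by have := ge l; rewrite lee_fin.
- by have := ge 0%N; rewrite leeNy_eq.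
Unshelve. all: by end_near. Qed.

End Equality.

Unset Implicit Arguments.

Theorem theorem5p14 (R : realType) (q : R) (u a nu : nat -> R)
  (N T : nat -> nat) (M : nat) :
  0 < q < 1 ->
  (forall i, (0 < i)%N -> u i < 0) ->
  (exists amin amax : R, 0 < amin /\
     forall i, (0 < i)%N -> amin <= a i <= amax) ->
  nu 1%N = 0 ->
  (exists numin numax : R, 0 < numin /\ numax < 1 /\
     forall i, (1 < i)%N -> numin <= nu i <= numax) ->
  (forall i j, (0 < i)%N -> (0 < j)%N -> a i * (nu j / a j) < 1) ->
  N 0%N = 1%N -> T 0%N = 0%N ->
  (forall s, (s < M)%N ->
     (N s.+1 = (N s).+1 /\ T s.+1 = T s) \/ (N s.+1 = N s /\ T s.+1 = (T s).+1)) ->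
  forall k : 'I_M.+1 -> int,
    ((fun K => (@PVbox R q u a nu N T M K k)%:E) @ \oo --> @PQ R q u a nu N T M k)%classic.
Proof.
move=> q01 u0 [amin [amax [amin0 ha]]] nu1 [numin [numax [numin0 [numax1 hnu]]]].
move=> ac N0 T0 path k.
have a0 i : (0 < i)%N -> 0 < a i.
  by move=> i0; have /andP[h _] := ha i i0; apply: lt_le_trans h.
have nu01 i : (0 < i)%N -> 0 <= nu i <= 1.
  case: i => [|[|i]] // _; first by rewrite nu1 lexx ler01.
  by have /andP[h1 h2] := hnu i.+2 isT; apply/andP; split; lra.
rewrite (PQ_ideal q01 u0 a0 nu01 nu1 ac N0 T0 path).
suff h : ((fun K => PVbox q u a nu N T K k) @ \oo --> ideal q u a nu N T k (N M) (T M))%classic.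
  by apply: cvg_EFin; [apply: nearW|exact: h].
(* Only the rows below [T M] enter, so this finite sum of positive terms bounds every relevant -
   u_t. *)
pose B := \sum_(t < T M) - u t.+1.
have uB t : (t < T M)%N -> - u t.+1 <= B.
  move=> tT; rewrite /B (bigD1 (Ordinal tT)) //= lerDl sumr_ge0 // => i _.
  by rewrite oppr_ge0 ltW // u0.
have B0 : 0 <= B by apply: sumr_ge0 => i _; rewrite oppr_ge0 ltW // u0.
have amax0 : 0 < amax.
  by have /andP[h1 h2] := ha 1%N isT; apply: lt_le_trans h2; apply: a0.
have nm0 : 0 < numax by have /andP[h1 h2] := hnu 2%N isT; lra.
have D0 : 0 < 1 + amax * B by rewrite ltr_pwDl // mulr_ge0 // ltW.
(* A vertex beyond column 1 emits no arrow with probability at least this: the numerator of the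
   weight is at least 1 - numax for either incoming bit, and the denominator is at most 1 + amax
   B. *)
apply: (PVbox_cvg q01 u0 a0 nu01 N0 T0 path (e := (1 - numax) / (1 + amax * B))).
  rewrite divr_gt0 //= ?subr_gt0 // ler_pdivrMr // mul1r.
  have : 0 <= amax * B by rewrite mulr_ge0 // ltW.
  by lra.
move=> x t g j x1 tT j1.
have x0 : (0 < x)%N by apply: ltnW.
have X0 := den_gt0 u0 a0 x0 (ltn0Sn t).
have XB : 1 - a x * u t.+1 <= 1 + amax * B.
  rewrite lerD2l -mulrN; apply: ler_pM => //; last exact: uB.
  - by rewrite ltW // a0.
  - by rewrite oppr_ge0 ltW // u0.
  - by have /andP[] := ha x x0.
have num0 : 0 <= (1 - numax) / (1 + amax * B) by rewrite divr_ge0 ?subr_ge0 // ltW.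
have keep A : 1 - numax <= A -> (1 - numax) / (1 + amax * B) <= A / (1 - a x * u t.+1).
  move=> hA; rewrite ler_pdivlMr //; apply: le_trans hA.
  by apply: le_trans (ler_wpM2l num0 XB) _; rewrite divfK // gt_eqF.
rewrite /Lw addn0 eqxx /=.
have g0 := ltW (expq_gt0 q01 g); have g1 := expq_le1 q01 g.
case: j j1 => [|[|]] // _; apply: keep.
  have : a x * u t.+1 * q ^+ g <= 0.
    by rewrite mulr_le0_ge0 // mulr_ge0_le0 // ltW ?a0 ?u0.
  by lra.
have /andP[h1 h2] := hnu x x1; have /andP[h3 h4] := nu01 x x0.
have : nu x * q ^+ g <= nu x by rewrite ler_piMr.
by lra.
Qed.
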